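(* Let $G$ be a group and $\phi:G\to G$ an automorphism. Suppose that $G$ is almost polycyclic, or, more generally, that $G$ belongs to some class of conjugacy separable groups which is closed under taking semidirect products by $\mathbb Z$, or, even more generally, that $G$ is $\phi$-conjugacy separable. If one of the numbers $R(\phi)$ and $S_f(\phi)$ is finite, then $R(\phi)=S_f(\phi)$.
   Context: Groups are countable discrete groups. Elements $x,x'\in G$ are $\phi$-conjugate if $x'=gx\phi(g^{-1})$ for some $g\in G$; $R(\phi)$ is the number of $\phi$-conjugacy classes. $S_f(\phi)$ is the number of equivalence classes of finite-dimensional irreducible unitary representations $\rho$ of $G$ such that $\rho\circ\phi$ is equivalent to $\rho$. A group is almost polycyclic if it has a normal polycyclic subgroup of finite index; polycyclic means having a finite subnormal series with cyclic factors ending in the trivial group. A group $G$ is conjugacy separable if any pair of non-conjugate elements of $G$ are non-conjugate in some finite quotient of $G$. A class of groups is closed under taking semidirect products by $\mathbb Z$ if for each $G$ in the class and each automorphism $\phi$ of $G$ the group $G\rtimes_\phi\mathbb Z$ (generator of $\mathbb Z$ acting by $\phi$) is in the class. $G$ is $\phi$-conjugacy separable with respect to an automorphism $\phi$ if for any pair $g,h$ of non-$\phi$-conjugate elements of $G$ there is a finite quotient $q:G\to Q$ respecting $\phi$ (i.e. $\phi$ induces an automorphism $\overline\phi$ of $Q$ with $q\circ\phi=\overline\phi\circ q$) such that $q(g)$ and $q(h)$ are not $\overline\phi$-conjugate in $Q$. *)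

(* Defs.v *)
From HB Require Import structures.
From mathcomp Require Import all_boot all_order all_fingroup all_algebra.
From mathcomp Require Import spectral complex.
From mathcomp Require Import boolp classical_sets functions cardinality reals.

Set Implicit Arguments.
Unset Strict Implicit.
Unset Printing Implicit Defensive.

Import Order.TTheory GRing.Theory Num.Theory.

Local Open Scope classical_set_scope.
Local Open Scope group_scope.

Record automorphism (G : groupType) := Automorphism {
  aut_mor :> {multiplicative G -> G};
  aut_inv : G -> G;
  aut_morK : cancel aut_mor aut_inv;
  aut_invK : cancel aut_inv aut_mor
}.

Definition twisted_conj (G : groupType) (phi : automorphism G) (x x' : G) :=
  exists g : G, x' = g * x * phi g^-1.

Definition twisted_classes (G : groupType) (phi : automorphism G) :
    set (set G) :=
  range (fun x : G => [set x' | twisted_conj phi x x']).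

Section Representations.
Variables (R : realType) (G : groupType).
Local Open Scope ring_scope.
Local Open Scope sesquilinear_scope.

(* G acts on the column vectors 'cV[R[i]]_n, with their standard Hermitian
   product, by v |-> rho g *m v. *)
Record unitary_rep := UnitaryRep {
  rep_dim : nat;
  rep_mx :> G -> 'M[R[i]]_rep_dim;
  rep_mx1 : rep_mx 1%g = 1%:M;
  rep_mxM : forall g h : G, rep_mx (g * h)%g = rep_mx g *m rep_mx h;
  rep_mx_unitary : forall g : G, rep_mx g \is unitarymx
}.

Definition irreducible_rep (rho : unitary_rep) :=
  (0 < rep_dim rho)%N /\
  forall W : {vspace 'cV[R[i]]_(rep_dim rho)},
    (forall (g : G) v, v \in W -> rho g *m v \in W) ->
    W = 0%VS \/ W = fullv.

(* For a rectangular matrix, [unitarymx] only says U *m U ^t* = 1; requiring it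
   of both U and U ^t* makes U a unitary isomorphism, and forces the dimensions
   to agree. *)
Definition equiv_rep (rho sigma : unitary_rep) :=
  exists U : 'M[R[i]]_(rep_dim sigma, rep_dim rho),
    [/\ U \is unitarymx, U ^t* \is unitarymx
      & forall g : G, U *m rho g = sigma g *m U].

Section Pullback.
Variables (rho : unitary_rep) (phi : automorphism G).

Lemma pullback_mx1 : rho (phi 1%g) = 1%:M.
Proof.
suff -> : phi 1%g = 1%g by exact: rep_mx1.
by apply: (@mulgI _ (phi 1%g)); rewrite -gmulfM !mulg1.
Qed.

Lemma pullback_mxM (g h : G) :
  rho (phi (g * h)%g) = rho (phi g) *m rho (phi h).
Proof. by rewrite gmulfM rep_mxM. Qed.

Definition pullback_rep : unitary_rep :=
  UnitaryRep pullback_mx1 pullback_mxM (fun g => rep_mx_unitary rho (phi g)).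

End Pullback.

Definition fixed_rep_classes (phi : automorphism G) : set (set unitary_rep) :=
  [set [set sigma | irreducible_rep sigma /\ equiv_rep rho sigma]
     | rho in [set rho | irreducible_rep rho /\
                         equiv_rep (pullback_rep rho phi) rho]].

End Representations.

Arguments fixed_rep_classes R {G} phi.

Section Polycyclic.
Variable G : groupType.
Implicit Types H K N : set G.

Definition expgz (x : G) (n : int) : G :=
  match n with Posz k => x ^+ k | Negz k => x ^- k.+1 end.

Definition is_subgroup H :=
  [/\ H 1, forall x y, H x -> H y -> H (x * y) & forall x, H x -> H x^-1].

Definition normal_in N H :=
  N `<=` H /\ forall x h, N x -> H h -> N (x ^ h).

(* The quotient H / N is generated by the coset of a. *)
Definition cyclic_factor N H :=
  exists2 a, H a & forall x, H x -> exists n : int, N ((expgz a n)^-1 * x).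

Definition polycyclic H :=
  exists (n : nat) (s : nat -> set G),
    [/\ s 0 = H, s n = [set 1],
        forall i, (i <= n)%N -> is_subgroup (s i)
      & forall i, (i < n)%N ->
          normal_in (s i.+1) (s i) /\ cyclic_factor (s i.+1) (s i)].

Definition finite_index H :=
  finite_set (range (fun g : G => [set g * h | h in H])).

Definition almost_polycyclic :=
  exists N : set G,
    [/\ is_subgroup N, normal_in N setT, polycyclic N & finite_index N].

End Polycyclic.

Definition conjugate (G : groupType) (x y : G) := exists g : G, y = x ^ g.

Definition conjugacy_separable (G : groupType) :=
  forall x y : G, ~ conjugate x y ->
    exists (Q : finGroupType) (q : {multiplicative G -> Q}),
      set_surj [set: G] [set: Q] q /\ ~ conjugate (q x) (q y).

Definition twisted_conjugacy_separable (G : groupType)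
    (phi : automorphism G) :=
  forall x y : G, ~ twisted_conj phi x y ->
    exists (Q : finGroupType) (q : {multiplicative G -> Q})
           (phibar : automorphism Q),
      [/\ set_surj [set: G] [set: Q] q,
          forall g : G, q (phi g) = phibar (q g)
        & ~ twisted_conj phibar (q x) (q y)].

Definition semidirectZ (G : groupType) (phi : automorphism G) : Type :=
  (G * int)%type.

Section SemidirectZ.
Variables (G : groupType) (phi : automorphism G).

Definition aut_expz (n : int) (x : G) : G :=
  match n with
  | Posz k => iter k phi x
  | Negz k => iter k.+1 (aut_inv phi) x
  end.

Lemma aut_morM : {morph phi : x y / x * y}.
Proof. exact: gmulfM. Qed.

Lemma aut_invM : {morph aut_inv phi : x y / x * y}.
Proof.
by move=> x y; apply: (can_inj (aut_morK phi)); rewrite aut_morM !aut_invK.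
Qed.

Lemma aut_expzM n : {morph aut_expz n : x y / x * y}.
Proof.
by case: n => n x y /=; elim: n => [|n /= ->] //=; rewrite ?aut_morM ?aut_invM.
Qed.

Lemma aut_expz1 n : aut_expz n 1 = 1.
Proof. by apply: (@mulgI _ (aut_expz n 1)); rewrite -aut_expzM !mulg1. Qed.

Lemma aut_expzS n x : aut_expz (n + 1)%R x = phi (aut_expz n x).
Proof.
case: n => n; first by rewrite -PoszD addn1.
case: n => [|n]; first by rewrite /= aut_invK.
have -> : (Negz n.+1 + 1 = Negz n)%R by rewrite !NegzE -addn1 PoszD opprD addrNK.
by rewrite /= aut_invK.
Qed.

Lemma aut_expzP n x : aut_expz (n - 1)%R x = aut_inv phi (aut_expz n x).
Proof. by rewrite -[in RHS](subrK 1%R n) aut_expzS aut_morK. Qed.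

Lemma aut_expzD m n x : aut_expz (m + n)%R x = aut_expz m (aut_expz n x).
Proof.
elim: m => [|m IH|m IH]; first by rewrite add0r.
- by rewrite -addn1 PoszD addrAC !aut_expzS IH.
- by rewrite -addn1 PoszD opprD addrAC !aut_expzP IH.
Qed.

HB.instance Definition _ := Choice.copy (semidirectZ phi) (G * int)%type.

(* The generator t = (1, 1) of the integers acts by phi: t x t^-1 = phi x. *)
Definition sdZ_mul (a b : semidirectZ phi) : semidirectZ phi :=
  (a.1 * aut_expz a.2 b.1, (a.2 + b.2)%R).
Definition sdZ_one : semidirectZ phi := (1, 0%R).
Definition sdZ_inv (a : semidirectZ phi) : semidirectZ phi :=
  (aut_expz (- a.2)%R a.1^-1, (- a.2)%R).

Lemma sdZ_mulA : associative sdZ_mul.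
Proof.
by move=> a b c; rewrite /sdZ_mul /= aut_expzM aut_expzD mulgA addrA.
Qed.

Lemma sdZ_mul1g : left_id sdZ_one sdZ_mul.
Proof. by case=> x m; rewrite /sdZ_mul /= mul1g add0r. Qed.

Lemma sdZ_mulg1 : right_id sdZ_one sdZ_mul.
Proof. by case=> x m; rewrite /sdZ_mul /= aut_expz1 mulg1 addr0. Qed.

Lemma sdZ_mulVg : left_inverse sdZ_one sdZ_inv sdZ_mul.
Proof.
by case=> x m; rewrite /sdZ_mul /= -aut_expzM mulVg aut_expz1 addNr.
Qed.

Lemma sdZ_mulgV : right_inverse sdZ_one sdZ_inv sdZ_mul.
Proof.
by case=> x m; rewrite /sdZ_mul /= -aut_expzD subrr /= mulgV.
Qed.

HB.instance Definition _ := isGroup.Build (semidirectZ phi)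
  sdZ_mulA sdZ_mul1g sdZ_mulg1 sdZ_mulVg sdZ_mulgV.

End SemidirectZ.

Definition closed_semidirectZ (C : groupType -> Prop) :=
  forall (H : groupType) (psi : automorphism H),
    C H -> C (semidirectZ psi : groupType).

(* Main.v *)
Require Import Defs.
From mathcomp Require Import all_boot all_order all_fingroup all_algebra.
From mathcomp Require Import boolp classical_sets functions cardinality reals.
From HB Require Import structures.
From mathcomp Require Import cyclic spectral complex.

(** The two numbers are compared through finite quotients.  Call a quotient
    [q : G -> Q] compatible when [phi] induces an automorphism of [Q].

    Representations.  If [V] intertwines an irreducible unitary [rho] with
    [rho \o phi], then [x |-> \tr (V *m rho x)] is constant on twisted
    conjugacy classes.  Coefficient functions of inequivalent irreducible
    representations are linearly independent ([coefficients_free], from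
    Schur's lemma and a bicommutant argument), so there are at most as many
    fixed representations as classes ([fixed_reps_le_classes]).  Conversely a
    twisted class function of a compatible finite quotient is a coefficient of
    the regular representation; decomposed over inequivalent irreducible
    representations, its invariance makes every component an intertwiner, which
    by Schur's lemma leaves one dimension for each fixed representation.  Hence
    there are at least as many fixed representations as classes in any
    compatible finite quotient ([classes_le_fixed_reps]).

    Consequently, whichever of the two numbers is finite, the numbers of classes
    of the compatible finite quotients are bounded.  If twisted classes are
    separated by finite quotients, finitely many of them are separated by one
    ([twisted_free_quotient]), so their number is finite, is attained in a
    finite quotient, and equals the number of fixed representations.

    Separation.  For a class of conjugacy separable groups closed under
    semidirect products by the integers, twisted conjugacy of [x] and [y] in
    [G] is conjugacy of [x * t] and [y * t] in the semidirect product
    ([conjugacy_separable_semidirectZ]).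

    For an almost polycyclic group the bound on the finite quotients replaces
    the conjugacy separability of such groups.  The class equation of twisted
    conjugation in a finite group writes 1 as a sum of inverses of orders of
    stabilizers, one term for each class; since 1 is a sum of a given number of
    unit fractions in finitely many ways, the stabilizers have bounded order
    ([stabilizer_bound], an observation of Jabara).  Up to a translation, the
    class of [z] is the set of values of the Lang map
    [lang b = b * (psi b)^-1], where [psi] is [phi] followed by conjugation,
    and the stabilizer is the fixed group of [psi].  On a finite abelian
    section, the image of the Lang map has as many cosets as [psi] has fixed
    points, so a fixed power of every element of an abelian layer of the
    derived series of a polycyclic subgroup of finite index is a value of the
    Lang map, up to the next layer, in every finite quotient, and then in [G]
    because subgroups of polycyclic groups are closed in the
    profinite topology ([polycyclic_separable]).  Going down the derived
    series, the Lang map is open ([lang_open]): its values contain a subgroup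
    generated by [n]-th powers, which has finite index.  So every twisted class
    is open, and the quotient by that subgroup separates it from the others. *)

Set Implicit Arguments.
Unset Strict Implicit.
Unset Printing Implicit Defensive.

Import Order.TTheory GRing.Theory Num.Theory.

Local Open Scope classical_set_scope.
Local Open Scope card_scope.

(** * Subgroups generated by powers *)

Section Subgroups.
Local Open Scope group_scope.
Variable G : groupType.
Implicit Types (x y g h a b : G) (H K N S T : set G) (m n : nat) (i j k : int).

Lemma subgroup1 H : is_subgroup H -> H 1.
Proof. by case. Qed.

Lemma subgroupM H x y : is_subgroup H -> H x -> H y -> H (x * y).
Proof. by case=> _ HM _; exact: HM. Qed.

Lemma subgroupV H x : is_subgroup H -> H x -> H x^-1.
Proof. by case=> _ _ HV; exact: HV. Qed.

Lemma subgroupX H x n : is_subgroup H -> H x -> H (x ^+ n).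
Proof.
move=> sH Hx; elim: n => [|n IH]; first exact: subgroup1.
by rewrite expgS; exact: subgroupM.
Qed.

Lemma expgzS x k : expgz x (k + 1)%R = expgz x k * x.
Proof.
case: k => k; first by rewrite -PoszD addn1 /= expgSr.
case: k => [|k]; first by rewrite /= expg1 mulVg.
have -> : (Negz k.+1 + 1 = Negz k)%R by rewrite !NegzE -addn1 PoszD opprD addrNK.
by rewrite /= (expgS x k.+1) invgM mulgVK.
Qed.

Lemma expgzP x k : expgz x (k - 1)%R = expgz x k * x^-1.
Proof. by rewrite -[in RHS](subrK 1%R k) expgzS mulgK. Qed.

Lemma expgzD x i j : expgz x (i + j)%R = expgz x i * expgz x j.
Proof.
elim: j => [|j IH|j IH]; first by rewrite addr0 mulg1.
- by rewrite -addn1 PoszD addrA !expgzS IH mulgA.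
- by rewrite -addn1 PoszD opprD addrA !expgzP IH mulgA.
Qed.

Lemma expgzN x k : expgz x (- k)%R = (expgz x k)^-1.
Proof. by apply: (@mulgI _ (expgz x k)); rewrite -expgzD subrr mulgV. Qed.

Lemma expgzM x i j : expgz x (i * j)%R = expgz (expgz x i) j.
Proof.
elim: j => [|j IH|j IH]; first by rewrite mulr0.
- by rewrite -addn1 PoszD mulrDr mulr1 expgzS -IH expgzD.
- by rewrite -addn1 PoszD opprD mulrDr mulrN1 expgzP -IH expgzD expgzN.
Qed.

Lemma subgroupXz H x k : is_subgroup H -> H x -> H (expgz x k).
Proof.
move=> sH Hx; case: k => k /=; first exact: subgroupX.
by apply: subgroupV => //; exact: subgroupX.
Qed.

Lemma subgroupI H K : is_subgroup H -> is_subgroup K -> is_subgroup (H `&` K).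
Proof.
move=> sH sK; split; first by split; exact: subgroup1.
- by move=> x y [Hx Kx] [Hy Ky]; split; exact: subgroupM.
- by move=> x [Hx Kx]; split; exact: subgroupV.
Qed.

Lemma subgroupT : is_subgroup [set: G].
Proof. by split. Qed.

Definition generated (X : set G) : set G :=
  [set x | forall H, is_subgroup H -> X `<=` H -> H x].

Lemma generated_subgroup X : is_subgroup (generated X).
Proof.
split; first by move=> H sH _; exact: subgroup1.
- by move=> x y gx gy H sH XH; apply: subgroupM => //; [exact: gx|exact: gy].
- by move=> x gx H sH XH; apply: subgroupV => //; exact: gx.
Qed.

Lemma sub_generated X : X `<=` generated X.
Proof. by move=> x Xx H _; apply. Qed.

Lemma generated_sub X H : is_subgroup H -> X `<=` H -> generated X `<=` H.
Proof. by move=> sH XH x; apply. Qed.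

Definition powers n H : set G := generated [set x ^+ n | x in H].

Lemma powers_subgroup n H : is_subgroup (powers n H).
Proof. exact: generated_subgroup. Qed.

Lemma powersX n H x : H x -> powers n H (x ^+ n).
Proof. by move=> Hx; apply: sub_generated; exists x. Qed.

Lemma powers_sub n H K :
  is_subgroup K -> (forall x, H x -> K (x ^+ n)) -> powers n H `<=` K.
Proof. by move=> sK HK; apply: generated_sub => // _ [x Hx <-]; exact: HK. Qed.

Lemma powersS n H K : H `<=` K -> powers n H `<=` powers n K.
Proof.
move=> HK; apply: powers_sub; first exact: powers_subgroup.
by move=> x Hx; apply: powersX; exact: HK.
Qed.

Lemma powers_subset n H : is_subgroup H -> powers n H `<=` H.
Proof. by move=> sH; apply: powers_sub => // x Hx; exact: subgroupX. Qed.

Lemma powersMl m n H : is_subgroup H -> powers (m * n) H `<=` powers m H.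
Proof.
move=> sH; apply: powers_sub; first exact: powers_subgroup.
move=> x Hx; rewrite expgnA.
by apply: (@subgroupX (powers m H)); [exact: powers_subgroup|exact: powersX].
Qed.

Lemma powersMr m n H : is_subgroup H -> powers (m * n) H `<=` powers n H.
Proof. by rewrite mulnC; exact: powersMl. Qed.

(** Subgroups generated by powers are stable under all endomorphisms, so they
    form a base of neighbourhoods on which normality and invariance under an
    automorphism come for free. *)
Lemma generated_morph (f : G -> G) X Y :
  {morph f : x y / x * y} -> (forall x, X x -> generated Y (f x)) ->
  forall x, generated X x -> generated Y (f x).
Proof.
move=> fM fX x gx.
have f1 : f 1 = 1 by apply: (@mulgI _ (f 1)); rewrite -fM !mulg1.
apply: (@generated_sub X [set z | generated Y (f z)]) => //; split=> /=.
- by rewrite f1; exact: subgroup1 (generated_subgroup Y).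
- by move=> u v fu fv; rewrite fM; exact: (subgroupM (generated_subgroup Y)).
- move=> u fu.
  have -> : f u^-1 = (f u)^-1 by apply: (@mulgI _ (f u)); rewrite -fM !mulgV.
  exact: (subgroupV (generated_subgroup Y)).
Qed.

Lemma endo_expg (f : G -> G) n :
  {morph f : x y / x * y} -> {morph f : x / x ^+ n}.
Proof.
move=> fM x; elim: n => [|n IH]; last by rewrite !expgS fM IH.
by rewrite !expg0; apply: (@mulgI _ (f 1)); rewrite -fM !mulg1.
Qed.

Lemma powers_morph (f : G -> G) n H :
  {morph f : x y / x * y} -> (forall x, H x -> H (f x)) ->
  forall x, powers n H x -> powers n H (f x).
Proof.
move=> fM fH; apply: generated_morph => // _ [x Hx <-].
by rewrite endo_expg //; apply: powersX; exact: fH.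
Qed.

Lemma conjg_morph g : {morph (fun x => x ^ g) : x y / x * y}.
Proof. by move=> x y; rewrite conjMg. Qed.

Lemma powers_normal n H g :
  (forall x, H x -> H (x ^ g)) -> forall x, powers n H x -> powers n H (x ^ g).
Proof. by apply: powers_morph; exact: conjg_morph. Qed.

(** Finiteness of the set of left cosets, as a list of representatives. *)
Definition finite_mod H S :=
  exists s : seq G, forall h, H h -> exists2 a, a \in s & S (a^-1 * h).

Lemma finite_modS H K S T :
  finite_mod H S -> K `<=` H -> S `<=` T -> finite_mod K T.
Proof.
by move=> [s Hs] KH ST; exists s => h /KH /Hs [a sa /ST]; exists a.
Qed.

Lemma finite_mod_trans H K S :
  finite_mod H K -> finite_mod K S -> finite_mod H S.
Proof.
move=> [s Hs] [t Ht]; exists [seq a * b | a <- s, b <- t] => h /Hs [a sa].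
move=> /Ht [b tb Sb]; exists (a * b); first by apply/allpairsP; exists (a, b).
by rewrite invgM -mulgA.
Qed.

Lemma pigeonhole H S : is_subgroup S -> finite_mod H S ->
  exists c : nat, forall u : nat -> G, (forall n, (n <= c)%N -> H (u n)) ->
    exists m n, [/\ (m < n)%N, (n <= c)%N & S ((u m)^-1 * u n)].
Proof.
move=> sS [s Hs]; exists (size s) => u Hu.
have /choice [r rP] : forall i : 'I_(size s).+1, exists l : 'I_(size s),
    S ((nth 1 s l)^-1 * u i).
  move=> i; have [|a sa Sa] := Hs (u i); first by apply: Hu; rewrite -ltnS.
  have lt_a : (index a s < size s)%N by rewrite index_mem.
  by exists (Ordinal lt_a); rewrite /= nth_index.
have /injectivePn [i [j nij rij]] : ~~ injectiveb r.
  by apply/injectiveP => /leq_card; rewrite !card_ord ltnn.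
wlog lt_ij : i j rij nij / (i < j)%N => [IH|].
  case: (ltngtP i j) => [||/val_inj ij]; first exact: IH.
  - by apply: IH => //; rewrite eq_sym.
  - by rewrite ij eqxx in nij.
exists i, j; split => //; first by rewrite -ltnS.
have := subgroupM sS (subgroupV sS (rP i)) (rP j).
by rewrite rij invgM invgK -mulgA mulVKg.
Qed.

(** Among the first powers of [x] two lie in the same coset, so some [x ^+ d]
    with [d] bounded lies in [S]; the factorial of the bound serves all [x] at
    once. *)
Lemma finite_mod_powers H S : is_subgroup H -> is_subgroup S ->
  finite_mod H S -> exists2 n, (0 < n)%N & powers n H `<=` S.
Proof.
move=> sH sS fin; have [c cP] := pigeonhole sS fin.
exists c`!; first exact: fact_gt0.
apply: powers_sub => // x Hx.
have [|i [j [ij jc Sij]]] := cP (fun n => x ^+ n).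
  by move=> n _; exact: subgroupX.
have -> : (c`! = (j - i) * (c`! %/ (j - i)))%N.
  by rewrite mulnC divnK // dvdn_fact // subn_gt0 ij (leq_trans (leq_subr _ _)).
rewrite expgnA; apply: subgroupX => //.
by move: Sij; rewrite -(subnKC (ltnW ij)) expgnDr mulKg addKn.
Qed.

End Subgroups.

(** * Polycyclic groups: powers and separability *)

Section Polycyclic.
Local Open Scope group_scope.
Variable G : groupType.
Implicit Types (x y g h a b : G) (H K N S T : set G) (m n : nat) (i j k : int).

Lemma modzB k (d : nat) : (k %% d)%Z = (- (d%:Z * (k %/ d)%Z) + k)%R.
Proof. by rewrite {3}(divz_eq k d) mulrC addKr. Qed.

Lemma modz_nat k (d : nat) : (0 < d)%N ->
  exists2 r : nat, (r < d)%N & (k %% d)%Z = r.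
Proof.
move=> d_gt0; have d0 : (d : int) != 0%R by case: d d_gt0.
have := @ltz_pmod k d; rewrite ltz_nat => /(_ d_gt0).
by case: (k %% d)%Z (modz_ge0 k d0) => // r _; exists r.
Qed.

Section CyclicFactor.
Variables (H K : set G) (a : G).
Hypotheses (sH : is_subgroup H) (sK : is_subgroup K) (nKH : normal_in K H).
Hypothesis Ha : H a.

(** [k] is a degree of [x] along the cyclic factor [H / K]: [x] and [a ^ k] have
    the same image there.  The degree is only defined modulo the order of the
    factor. *)
Let coset_deg k x := K ((expgz a k)^-1 * x).

Lemma normal_inJ x h : K x -> H h -> K (x ^ h).
Proof. by case: nKH => _; apply. Qed.

Lemma normal_inJV x h : K x -> H h -> K (h * x * h^-1).
Proof.
move=> Kx Hh; have := normal_inJ Kx (subgroupV sH Hh).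
by rewrite conjgE invgK mulgA.
Qed.

Lemma coset_degM i j x y : H x -> H y ->
  coset_deg i x -> coset_deg j y -> coset_deg (i + j)%R (x * y).
Proof.
move=> Hx Hy Kx Ky; have Haj := subgroupXz j sH Ha.
have := subgroupM sK (normal_inJ Kx Haj) Ky.
by rewrite /coset_deg expgzD invgM conjgE !mulgA mulgK.
Qed.

Lemma coset_degV i x : H x -> coset_deg i x -> coset_deg (- i)%R x^-1.
Proof.
move=> Hx Kx; have := subgroupV sK (normal_inJV Kx (subgroupXz i sH Ha)).
by rewrite /coset_deg expgzN mulVKg invgM !invgK.
Qed.

Lemma coset_degXn i x n : H x -> coset_deg i x -> coset_deg (i * n)%R (x ^+ n).
Proof.
move=> Hx Kx; elim: n => [|n IH].
  by rewrite mulr0 /coset_deg /= invg1 mulg1; exact: subgroup1.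
rewrite -addn1 PoszD mulrDr mulr1 addn1 expgSr.
by apply: coset_degM => //; exact: subgroupX.
Qed.

Lemma coset_degXz i x j : H x -> coset_deg i x -> coset_deg (i * j)%R (expgz x j).
Proof.
move=> Hx Kx; case: j => n; first exact: coset_degXn.
rewrite NegzE mulrN; apply: coset_degV; first exact: subgroupX.
exact: coset_degXn.
Qed.

Lemma coset_deg0 x : coset_deg 0%R x = K x.
Proof. by rewrite /coset_deg /= invg1 mul1g. Qed.

Hypothesis Hcyc : forall x, H x -> exists k : int, coset_deg k x.

(** An element of least positive degree generates, by division of degrees; when
    no element of [S] has positive degree, [S] is contained in [K]. *)
Lemma cyclic_factor_sub S : is_subgroup S -> S `<=` H -> cyclic_factor (S `&` K) S.
Proof.
move=> sS SH.
have [[d1 d1P]|nod] := pselect (exists d : nat, (0 < d)%N /\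
    exists2 x, S x & coset_deg d x).
  pose pd d := `[< (0 < d)%N /\ exists2 x, S x & coset_deg d x >].
  have exd : exists d, pd d by exists d1; exact/asboolP.
  case: (ex_minnP exd) => d /asboolP [d_gt0 [b Sb Kb]] dmin.
  exists b => // x Sx; have [k Kx] := Hcyc (SH _ Sx).
  exists (k %/ d)%Z; set y := _ * x.
  have Sy : S y by apply: subgroupM => //; apply: subgroupV => //; exact: subgroupXz.
  split=> //; rewrite -coset_deg0.
  have Ky : coset_deg (k %% d)%Z y.
    rewrite modzB; have Hb := SH _ Sb; apply: coset_degM => //.
    - by apply: subgroupV => //; exact: subgroupXz.
    - exact: SH.
    - by apply: coset_degV; [exact: subgroupXz|exact: coset_degXz].
  have [r lt_r kr] := modz_nat k d_gt0; rewrite kr in Ky.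
  case: r kr lt_r Ky => // r kr lt_r Ky.
  suff : (d <= r.+1)%N by rewrite leqNgt lt_r.
  by apply: dmin; apply/asboolP; split => //; exists y.
exists 1; first exact: subgroup1.
move=> x Sx; exists 0%R; rewrite /= invg1 mul1g; split=> //.
have [k Kx] := Hcyc (SH _ Sx).
case: k Kx => [[|k] Kx|k Kx]; first by rewrite coset_deg0 in Kx.
  by case: nod; exists k.+1; split=> //; exists x.
case: nod; exists k.+1; split=> //; exists x^-1; first exact: subgroupV.
by have := coset_degV (SH _ Sx) Kx; rewrite NegzE opprK.
Qed.

(** Modulo [n]-th powers only the degrees below [n] remain. *)
Lemma finite_mod_powers_cyclic n : (0 < n)%N ->
  finite_mod K (powers n K) -> finite_mod H (powers n H).
Proof.
move=> n_gt0 [t Ht].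
exists [seq a ^+ r * c | r <- iota 0 n, c <- t] => h Hh.
have [k Kh] := Hcyc Hh.
pose w := expgz (expgz a (k %/ n)%Z) n.
have Hq := subgroupXz (k %/ n)%Z sH Ha.
have Hw : H w by exact: subgroupXz.
have powM := subgroupM (powers_subgroup n H).
have pw : powers n H w by exact: powersX.
have [c tc Kc] := Ht _ (normal_inJV Kh Hw).
have -> : h = expgz a (k %% n)%Z * w * ((expgz a k)^-1 * h).
  by rewrite /w -expgzM -expgzD addrC -divz_eq mulVKg.
have [r lt_r ->] := modz_nat k n_gt0.
exists (a ^+ r * c).
  apply/allpairsP; exists (r, c); split => //=.
  by rewrite mem_iota /= add0n.
have := powM _ _ (powersS nKH.1 Kc) pw.
by rewrite /= !invgM !mulgA !mulgVK.
Qed.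

(** When [b] has non-zero degree along the cyclic factor, [powers m K] and [b]
    generate a subgroup of finite index, which therefore contains some
    [powers n H]; it adds to [powers m K] nothing but powers of [b]. *)
Lemma powers_sub_cyclic b (d m : nat) : (0 < d)%N -> H b -> coset_deg d b ->
  finite_mod K (powers m K) ->
  exists2 n, (0 < n)%N & forall p, powers n H p ->
    exists u j, powers m K u /\ p = u * expgz b j.
Proof.
move=> d_gt0 Hb Kb [t Ht].
pose L : set G := [set p | exists u j, powers m K u /\ p = u * expgz b j].
have sP := powers_subgroup m K.
have PJ u j : powers m K u -> powers m K (expgz b j * u * (expgz b j)^-1).
  move=> Pu; have := @powers_normal _ m K (expgz b j)^-1 _ u Pu.
  rewrite conjgE invgK mulgA; apply=> x Kx; apply: normal_inJ => //.
  by apply: subgroupV => //; exact: subgroupXz.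
have sL : is_subgroup L.
  split.
  - by exists 1, 0%R; rewrite mulg1; split=> //; exact: subgroup1.
  - move=> _ _ [u [i [Pu ->]]] [v [j [Pv ->]]].
    exists (u * (expgz b i * v * (expgz b i)^-1)), (i + j)%R.
    split; first by apply: (subgroupM sP) => //; exact: PJ.
    by rewrite expgzD !mulgA mulgVK.
  - move=> _ [u [i [Pu ->]]].
    exists (expgz b (- i)%R * u^-1 * (expgz b (- i)%R)^-1), (- i)%R.
    split; first by apply: PJ; exact: (subgroupV sP).
    by rewrite mulgVK invgM expgzN.
have finL : finite_mod H L.
  exists [seq a ^+ r * c | r <- iota 0 d, c <- t] => h Hh.
  have [k Kh] := Hcyc Hh.
  pose y := h * (expgz b (k %/ d)%Z)^-1.
  have Hy : H y by apply: subgroupM => //; apply: subgroupV => //; exact: subgroupXz.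
  have Ky : coset_deg (k %% d)%Z y.
    rewrite modzB addrC; apply: coset_degM => //.
    - by apply: subgroupV => //; exact: subgroupXz.
    - by apply: coset_degV; [exact: subgroupXz|exact: coset_degXz].
  have [r lt_r kr] := modz_nat k d_gt0; rewrite kr in Ky.
  have [c tc Kc] := Ht _ Ky.
  exists (a ^+ r * c).
    apply/allpairsP; exists (r, c); split => //=.
    by rewrite mem_iota /= add0n.
  exists (c^-1 * ((expgz a r)^-1 * y)), (k %/ d)%Z; split=> //.
  by rewrite /y /= !invgM !mulgA mulgVK.
have [n n_gt0 nL] := finite_mod_powers sH sL finL.
by exists n => // p /nL.
Qed.

End CyclicFactor.

Lemma polycyclic_ind (P : set G -> Prop) :
  P [set 1] ->
  (forall H K a, is_subgroup H -> is_subgroup K -> normal_in K H -> H a ->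
    (forall x, H x -> exists k : int, K ((expgz a k)^-1 * x)) ->
    P K -> P H) ->
  forall H, polycyclic H -> P H.
Proof.
move=> P1 PS H [n [s [<- sn sub fac]]].
elim: n s sn sub fac => [|n IH] s sn sub fac; first by rewrite sn.
have [nor [a sa acyc]] := fac 0%N isT.
apply: (PS _ (s 1%N) a) => //; [exact: sub|exact: sub|].
apply: (IH (fun l => s l.+1)) => // i ltin; [exact: sub|exact: fac].
Qed.

Lemma polycyclic_sub H S : is_subgroup S -> S `<=` H -> polycyclic H -> polycyclic S.
Proof.
move=> sS SH [n [s [s0 sn sub fac]]]; exists n, (fun l => S `&` s l); split.
- by rewrite s0; apply/setIidPl.
- rewrite sn; apply/seteqP; split=> [x [] //|x /= ->]; split=> //; exact: subgroup1.
- by move=> i lein; apply: subgroupI => //; exact: sub.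
- move=> i ltin; have [nor [a sa acyc]] := fac i ltin.
  have sI := subgroupI sS (sub i (ltnW ltin)).
  split.
    split; first by move=> x [Sx /nor.1].
    move=> x h [Sx six] [Sh sih]; split; last exact: nor.2.
    by rewrite conjgE; apply: subgroupM => //; [exact: subgroupV|exact: subgroupM].
  have := @cyclic_factor_sub _ _ a (sub _ (ltnW ltin)) (sub _ ltin) nor sa acyc _ sI.
  rewrite -setIA (_ : s i `&` s i.+1 = s i.+1); first by apply; exact: subIsetr.
  by apply/setIidPr; exact: nor.1.
Qed.

Lemma polycyclic_finite_mod_powers H n : (0 < n)%N -> polycyclic H ->
  finite_mod H (powers n H).
Proof.
move=> n_gt0; move: H; apply: polycyclic_ind => [|H K a sH sK nKH Ha Hcyc].
  exists [:: 1] => h /= ->; exists 1; rewrite ?mem_head // mulVg.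
  exact: (subgroup1 (powers_subgroup _ _)).
exact: (finite_mod_powers_cyclic sH nKH Ha Hcyc n_gt0).
Qed.

(** Mal'cev's theorem.  Along a cyclic factor [H / K], the point [x] is first
    moved into [K]: either [S] has an element of non-zero degree, and the powers of this
    element absorb those of [H] outside [K], or [H / K] is infinite cyclic and
    [S] is contained in [K], and the degree of [x] is divisible by every
    integer. *)
Lemma polycyclic_separable H S x : polycyclic H -> is_subgroup S -> S `<=` H ->
  H x ->
  (forall n, (0 < n)%N -> exists2 p, powers n H p & S (p^-1 * x)) -> S x.
Proof.
move=> pH; move: S x.
suff : (forall n, (0 < n)%N -> finite_mod H (powers n H)) /\
  forall S x, is_subgroup S -> S `<=` H -> H x ->
  (forall n, (0 < n)%N -> exists2 p, powers n H p & S (p^-1 * x)) -> S x.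
  by case.
move: H pH; apply: polycyclic_ind => [|H K a sH sK nKH Ha Hcyc [finK IH]].
  split=> [n _|S x sS _ -> _]; last exact: subgroup1.
  exists [:: 1] => h /= ->; exists 1; rewrite ?mem_head // mulVg.
  exact: (subgroup1 (powers_subgroup _ _)).
split=> [n n_gt0|S x sS SH Hx clx].
  exact: (finite_mod_powers_cyclic sH nKH Ha Hcyc n_gt0 (finK n n_gt0)).
have KpS m u : powers m K u -> K u by exact: powers_subset.
suff key m : (0 < m)%N -> exists2 u, powers m K u & S (u^-1 * x).
  have [u Pu Sux] := key 1%N isT.
  have Ku := KpS _ _ Pu.
  suff : (S `&` K) u.
    by case=> Su _; rewrite -(mulVKg u x); exact: (subgroupM sS Su Sux).
  apply: (IH _ _ (subgroupI sS sK) (@subIsetr _ _ _) Ku).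
  move=> m m_gt0; have [v Pv Svx] := key m m_gt0; exists v => //.
  split; last by apply: subgroupM => //; apply: subgroupV => //; exact: KpS _ _ Pv.
  have := subgroupM sS Svx (subgroupV sS Sux).
  by rewrite invgM invgK !mulgA mulgK.
move=> m_gt0; have finKm := finK m m_gt0.
have [[b [d [d_gt0 Sb Kb]]]|nob] := pselect (exists b (d : nat),
    [/\ (0 < d)%N, S b & K ((expgz a d)^-1 * b)]).
  have [n n_gt0 nP] :=
    powers_sub_cyclic sH sK nKH Ha Hcyc d_gt0 (SH _ Sb) Kb finKm.
  have [p /nP [u [j [Pu ->]]] Spx] := clx n n_gt0; exists u => //.
  have := subgroupM sS (subgroupXz j sS Sb) Spx.
  by rewrite invgM !mulgA mulgV mul1g.
(* The element 1 of [S] has degree [k] whenever [a ^ k] lies in [K]. *)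
have nodeg k : K (expgz a k) -> k = 0%R.
  have nat_case (l : nat) : K (expgz a l) -> l = 0%N.
    case: l => // l Kl; case: nob; exists 1, l.+1; split=> //.
      exact: subgroup1.
    by rewrite mulg1; exact: subgroupV.
  case: k => l Kl; first by rewrite (nat_case l Kl).
  have /= := subgroupV sK Kl; rewrite invgK => Kl'.
  by have := nat_case l.+1 Kl'.
have SK s : S s -> K s.
  move=> Ss; have [[[|k]|k] Ks] := Hcyc _ (SH _ Ss).
  - by rewrite /= invg1 mul1g in Ks.
  - by case: nob; exists s, k.+1.
  - case: nob; exists s^-1, k.+1; split=> //; first exact: subgroupV.
    by have := coset_degV sH sK nKH Ha (SH _ Ss) Ks; rewrite NegzE opprK.
have [k Kx] := Hcyc _ Hx.
pose d := `|k|.+1%N; pose b := expgz a d.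
have Hb : H b by exact: subgroupXz.
have Kb : K ((expgz a d)^-1 * b) by rewrite mulVg; exact: subgroup1.
have [n n_gt0 nP] := powers_sub_cyclic sH sK nKH Ha Hcyc (ltn0Sn _) Hb Kb finKm.
have [p /nP [u [j [Pu ->]]] Spx] := clx n n_gt0.
have Hp : H (u * expgz b j).
  by apply: subgroupM => //; [exact: nKH.1 _ (KpS _ _ Pu)|exact: subgroupXz].
have Kp : K ((expgz a (d%:Z * j)%R)^-1 * (u * expgz b j)).
  rewrite -[(_ * j)%R]add0r; apply: (coset_degM sH sK nKH Ha) => //.
  - exact: nKH.1 _ (KpS _ _ Pu).
  - exact: subgroupXz.
  - by rewrite /= invg1 mul1g; exact: KpS _ _ Pu.
  - exact: (coset_degXz sH sK nKH Ha).
have Ky : K ((expgz a (- (d%:Z * j) + k)%R)^-1 * ((u * expgz b j)^-1 * x)).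
  apply: (coset_degM sH sK nKH Ha) => //; first exact: subgroupV.
  exact: (coset_degV sH sK nKH Ha).
have degK i y : K y -> K ((expgz a i)^-1 * y) -> K (expgz a i).
  move=> Ky' Kiy; have := subgroupM sK Ky' (subgroupV sK Kiy).
  by rewrite invgM invgK mulgA mulgV mul1g.
have /nodeg /eqP := degK _ _ (SK _ Spx) Ky.
rewrite addrC subr_eq0 => /eqP kdj.
have j0 : j = 0%R.
  apply/eqP; rewrite -absz_eq0 -leqn0 leqNgt; apply/negP => j_gt0.
  have : (`|k| = d * `|j|)%N by rewrite kdj abszM.
  by move/eqP; rewrite ltn_eqF // (leq_trans (ltnSn `|k|%N)) // leq_pmulr.
exists u => //.
by move: Spx; rewrite j0 /= mulg1.
Qed.

End Polycyclic.

(** * Twisted conjugacy in finite groups *)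

(** If finitely many unit fractions sum to a given [q], then the smallest
    denominator is at most the number of terms divided by [q], which leaves
    finitely many values for the sum of the other terms. *)
Lemma unit_fraction_bound (n : nat) (q : rat) : exists N : nat,
  forall s : seq nat, (size s <= n)%N -> (0 \notin s)%N ->
    (\sum_(d <- s) d%:R^-1 = q)%R -> forall d, d \in s -> (d <= N)%N.
Proof.
elim: n q => [|n IH] q; first by exists 0%N => s; rewrite leqn0 size_eq0 => /eqP ->.
have /choice [B BP] := fun d : nat => IH (q - d%:R^-1)%R.
have [K KP] : exists K : nat, (q > 0)%R -> (n.+1%:R / q < K%:R :> rat)%R.
  by exists (Num.truncn (n.+1%:R / q)%R).+1 => _; exact: truncnS_gt.
exists (\max_(d < K.+1) maxn d (B d)) => s sz s0 sq d ds.
have pos e : e \in s -> (0 < e%:R :> rat)%R.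
  by move=> es; rewrite ltr0n lt0n; apply: contraNneq s0 => <-.
have q_gt0 : (q > 0)%R.
  rewrite -sq (perm_big _ (perm_to_rem ds)) /= big_cons.
  apply: ltr_wpDr; last by rewrite invr_gt0 pos.
  by rewrite big_seq; apply: sumr_ge0 => e /mem_rem es; rewrite invr_ge0 ltW ?pos.
have /hasP [e es eK] : has (fun e => (e <= K)%N) s.
  apply: contraT => /hasPn big.
  have : (q <= \sum_(e <- s) K%:R^-1)%R.
    rewrite -sq big_seq [leRHS]big_seq; apply: ler_sum => e es.
    have := big e es; rewrite -ltnNge => /ltnW Ke.
    have K_gt0 : (0 < K%:R :> rat)%R.
      by apply: lt_trans (KP q_gt0); rewrite divr_gt0 // ltr0n.
    by rewrite lef_pV2 ?ler_nat ?posrE ?(pos _ es).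
  have K_gt0 : (0 < K%:R :> rat)%R.
    by apply: lt_trans (KP q_gt0); rewrite divr_gt0 // ltr0n.
  rewrite big_const_seq count_predT iter_addr_0 -[leRHS]mulr_natr ler_pdivlMl // => Kq; have := KP q_gt0; rewrite ltr_pdivrMr // => lt1.
  have : (n.+1%:R < (size s)%:R :> rat)%R by exact: lt_le_trans lt1 Kq.
  by rewrite ltr_nat ltnNge sz.
have lt_e : (e < K.+1)%N by [].
apply: leq_trans (leq_bigmax (Ordinal lt_e)) => /=; rewrite leq_max.
have := ds; rewrite (perm_mem (perm_to_rem es)) inE => /orP [/eqP -> |dr].
  by rewrite leqnn.
apply/orP; right; apply: (BP e (rem e s)) => //.
- by rewrite size_rem // -ltnS prednK // -has_predT; apply/hasP; exists e.
- by apply: contra s0 => /mem_rem.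
- by rewrite -sq (perm_big _ (perm_to_rem es)) /= big_cons addrAC subrr add0r.
Qed.

Section MultiplicativeMorphisms.
Local Open Scope group_scope.
Variables (G H : groupType) (f : {multiplicative G -> H}).

Lemma mult1 : f 1 = 1.
Proof. by apply: (@mulgI _ (f 1)); rewrite -gmulfM !mulg1. Qed.

Lemma multV x : f x^-1 = (f x)^-1.
Proof. by apply: (@mulgI _ (f x)); rewrite -gmulfM !mulgV mult1. Qed.

Lemma multX x n : f (x ^+ n) = f x ^+ n.
Proof.
by elim: n => [|n IH]; [exact: mult1|rewrite !expgS gmulfM IH].
Qed.

End MultiplicativeMorphisms.

(** Families of pairwise non-conjugate elements: a way to bound numbers of
    classes without counting them. *)
Definition twisted_free (G : groupType) (phi : automorphism G) k (x : 'I_k -> G) :=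
  forall i j, twisted_conj phi (x i) (x j) -> i = j.

Section FiniteTwisted.
Local Open Scope group_scope.
Variables (Q : finGroupType) (phi : automorphism Q).

Definition twisted_fun (x g : Q) := g^-1 * x * phi g.

Lemma twisted_fun1 : twisted_fun^~ 1 =1 id.
Proof. by move=> x; rewrite /twisted_fun mult1 invg1 mul1g mulg1. Qed.

Lemma twisted_funM x : act_morph twisted_fun x.
Proof. by move=> a b; rewrite /twisted_fun gmulfM invgM !mulgA. Qed.

Definition twisted_action := TotalAction twisted_fun1 twisted_funM.

Let classes := orbit twisted_action [set: Q]%SET @: [set: Q]%SET.

Lemma card_twisted_classes M :
  (forall k (x : 'I_k -> Q), twisted_free phi x -> (k <= M)%N) ->
  (#|classes| <= M)%N.
Proof.
move=> bM.
have /choice [x xP] : forall i : 'I_#|classes|, exists x,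
    enum_val i = orbit twisted_action [set: Q]%SET x.
  by move=> i; have /imsetP [x _ ->] := enum_valP i; exists x.
apply: (bM _ x) => i j [g gP]; apply: enum_val_inj; rewrite !xP.
apply/orbit_eqP; rewrite orbit_sym; apply/imsetP; exists g^-1; first by rewrite inE.
by rewrite /= /twisted_fun invgK.
Qed.

(** Jabara's observation: by the class equation of the twisted conjugation
    action, the inverses of the orders of the stabilizers, one for each class,
    add up to 1. *)
Lemma stabilizer_unit_fractions z : exists s : seq nat,
  [/\ size s = #|classes|, (0 \notin s)%N, (\sum_(d <- s) d%:R^-1 = 1 :> rat)%R
    & #|[set g | g * z == z * phi g]%SET| \in s].
Proof.
have cardO x : (#|orbit twisted_action [set: Q]%SET x| *
    #|'C[x | twisted_action]| = #|Q|)%N.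
  by rewrite -[RHS]cardsT -(card_orbit_stab twisted_action [set: Q]%G x) finset.setTI.
pose d (B : {set Q}) := (#|Q| %/ #|B|)%N.
have dE x : d (orbit twisted_action [set: Q]%SET x) = #|'C[x | twisted_action]|.
  rewrite /d -(cardO x) mulKn // card_gt0; apply/set0Pn; exists x.
  exact: orbit_refl.
exists [seq d B | B <- enum classes]; split.
- by rewrite size_map -cardE.
- apply/negP => /mapP [B]; rewrite mem_enum => /imsetP [x _ ->].
  rewrite dE => e0; have := cardG_gt0 'C[x | twisted_action]%G.
  by rewrite /= -e0.
- rewrite big_map big_enum.
  have Q_gt0 : (#|Q|%:R != 0 :> rat)%R by rewrite pnatr_eq0 -cardsT -lt0n cardG_gt0.
  apply: (mulfI Q_gt0); rewrite mulr1 mulr_sumr -[in RHS]cardsT.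
  have acts : [acts [set: Q]%SET, on [set: Q]%SET | twisted_action].
    by apply/actsP => g _ y; rewrite !inE.
  rewrite (card_partition (orbit_partition acts)) natr_sum.
  apply: eq_bigr => _ /imsetP [x _ ->]; rewrite dE -(cardO x) natrM mulfK //.
  by rewrite pnatr_eq0 -lt0n (cardG_gt0 'C[x | twisted_action]%G).
- apply/mapP; exists (orbit twisted_action [set: Q]%SET z).
    by rewrite mem_enum; apply/imsetP; exists z.
  rewrite dE; apply: eq_card => g; rewrite inE.
  apply/eqP/astab1P => /= [gz|]; rewrite /twisted_fun.
    by rewrite -mulgA -gz mulKg.
  by move=> e; rewrite -[in LHS]e !mulgA mulgV mul1g.
Qed.

End FiniteTwisted.

(** The bound depends on the number of classes alone, so it holds uniformly over
    all compatible finite quotients of a group. *)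
Lemma stabilizer_bound (M : nat) : exists c : nat,
  forall (Q : finGroupType) (phi : automorphism Q),
    (forall k (x : 'I_k -> Q), twisted_free phi x -> (k <= M)%N) ->
    forall z : Q, (#|[set g | (g * z == z * phi g)%g]%SET| <= c)%N.
Proof.
have [c cP] := unit_fraction_bound M 1; exists c => Q phi bM z.
have [s [sz s0 s1 zs]] := stabilizer_unit_fractions phi z.
by apply: cP zs => //; rewrite sz; exact: card_twisted_classes.
Qed.

Section LangMapExponent.
Local Open Scope group_scope.

(** On a finite abelian group, an endomorphism has as many fixed points as
    [a |-> a * (psi a)^-1] has cosets of its image. *)
Lemma lang_map_exponent (Q : finGroupType) (psi : automorphism Q)
    (A : {group Q}) (c : nat) : abelian A ->
  (forall a, a \in A -> psi a \in A) ->
  (#|[set g | psi g == g]%SET| <= c)%N ->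
  forall a, a \in A -> exists2 b, b \in A & (a ^+ c`! = b * (psi b)^-1)%g.
Proof.
move=> abA psiA le_c a Aa.
pose f b := (b * (psi b)^-1)%g.
have AfV b : b \in A -> (psi b)^-1%g \in A by move=> /psiA; rewrite groupV.
have fM : {in A &, {morph f : x y / (x * y)%g}}.
  move=> x y Ax Ay; rewrite /f gmulfM invgM !mulgA.
  rewrite -!(mulgA x); congr (x * _)%g.
  rewrite -[LHS]mulgA -[RHS]mulgA.
  have -> : ((psi x)^-1 * (y * (psi y)^-1) = y * ((psi x)^-1 * (psi y)^-1))%g.
    by rewrite !mulgA [((psi x)^-1 * y)%g](centsP abA) ?AfV.
  by congr (y * _)%g; rewrite (centsP abA) ?AfV.
pose F := Morphism fM.
have FA : F @* A \subset A.
  by apply/fintype.subsetP => _ /morphimP [b Ab _ ->] /=; rewrite groupM ?AfV.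
have ker_le : (#|'ker F| <= c)%N.
  apply: leq_trans le_c; apply: subset_leq_card; apply/fintype.subsetP => b /morphpreP [Ab].
  rewrite !inE /= => /eqP fb1; apply/eqP.
  by rewrite -[RHS](mulgKV (psi b)) -/(f b) fb1 mul1g.
have ind_le : (#|A : F @* A| <= c)%N.
  have := card_morphim F A; rewrite finset.setIid => cFA.
  suff -> : #|A : F @* A| = #|'ker F| by [].
  apply/eqP; rewrite -(eqn_pmul2l (cardG_gt0 [group of F @* A])) Lagrange //=.
  by rewrite cFA mulnC Lagrange // subsetIl.
have nFA : A \subset 'N(F @* A).
  by apply: cents_norm; exact: fintype.subset_trans abA (centS FA).
suff /morphimP [b Ab _ ->] : (a ^+ c`!)%g \in F @* A by exists b.
have /dvdnP [e ->] : (#|A : F @* A| %| c`!)%N.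
  by rewrite dvdn_fact // ind_le andbT indexg_gt0.
rewrite mulnC expgM groupX //.
rewrite -(card_quotient nFA); apply: coset_idr; first by rewrite groupX // (fintype.subsetP nFA).
by rewrite morphX ?(fintype.subsetP nFA) // expg_cardG // mem_quotient.
Qed.

End LangMapExponent.

(** * Finite quotients and the semidirect product *)

Section Quotients.
Local Open Scope group_scope.

Definition multiplicative_of (G H : groupType) (f : G -> H)
    (fM : {morph f : x y / x * y}) : {multiplicative G -> H} :=
  HB.pack_for {multiplicative G -> H} f (isMultiplicative.Build G H f fM).

Lemma induced_automorphism (G Q : groupType) (q : {multiplicative G -> Q})
    (phi : automorphism G) :
  set_surj [set: G] [set: Q] q -> (forall x, q x = 1 <-> q (phi x) = 1) ->
  exists phibar : automorphism Q, forall g, q (phi g) = phibar (q g).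
Proof.
move=> qsurj ker.
have /choice [p pP] : forall y, exists x, q x = y.
  by move=> y; have [x _ <-] := qsurj y I; exists x.
have eqphi x y : q x = q y <-> q (phi x) = q (phi y).
  have qE (u v : G) : q u = q v <-> q (u * v^-1) = 1.
    rewrite gmulfM multV; split=> [->|/divg1_eq //].
    exact: mulgV.
  by rewrite (qE x) (qE (phi x)) ker (@gmulfM _ _ phi) (@multV _ _ phi).
pose f y := q (phi (p y)); pose f' y := q (aut_inv phi (p y)).
have fE x : f (q x) = q (phi x) by apply: (eqphi _ _).1; rewrite pP.
have f'E x : f' (q x) = q (aut_inv phi x).
  by apply: (eqphi _ _).2; rewrite !aut_invK pP.
have fM : {morph f : x y / x * y}.
  by move=> x y; rewrite -(pP x) -(pP y) -gmulfM !fE !gmulfM.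
have fK : cancel f f' by move=> y; rewrite -(pP y) fE f'E aut_morK.
have f'K : cancel f' f by move=> y; rewrite -(pP y) f'E fE aut_invK.
by exists (@Automorphism Q (multiplicative_of fM) f' fK f'K) => g; rewrite /= fE.
Qed.

(** Replacing a finite group by the image of [f] makes the map surjective without
    changing which elements it identifies. *)
Lemma image_quotient (G : groupType) (F : finGroupType)
    (f : {multiplicative G -> F}) :
  exists (Q : finGroupType) (q : {multiplicative G -> Q})
    (iota : {multiplicative Q -> F}),
    [/\ set_surj [set: G] [set: Q] q, injective iota & forall x, iota (q x) = f x].
Proof.
pose A : {set F} := [set y | `[< exists x, f x = y >]]%SET.
have gA : group_set A.
  apply/group_setP; split; first by rewrite !inE; exists 1; exact: mult1.
  move=> x y; rewrite !inE; case=> u <-; case=> v <-.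
  by exists (u * v); rewrite gmulfM.
pose AG := Group gA.
have Af x : f x \in AG by rewrite !inE; exists x.
have qM : {morph (fun x => subg AG (f x)) : x y / x * y}.
  by move=> x y; rewrite gmulfM subgM.
have iM : {morph (fun x : subg_of AG => sgval x) : x y / x * y} by [].
exists (subg_of AG), (multiplicative_of qM), (multiplicative_of iM).
split=> /= [y _|x y|x].
- have := subgP y; rewrite !inE => -[x fx]; exists x => //=.
  by apply: val_inj; rewrite /= subgK // fx.
- exact: val_inj.
- by rewrite subgK.
Qed.

(** The permutation action of [G] on the finitely many left cosets of [S]; since
    [S] is normal, the kernel is [S] itself. *)
Lemma coset_quotient (G : groupType) (S : set G) :
  is_subgroup S -> (forall x g, S x -> S (x ^ g)) -> finite_mod setT S ->
  exists (F : finGroupType) (f : {multiplicative G -> F}),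
    forall x, f x = 1 <-> S x.
Proof.
move=> sS nS [s sP].
have S_trans x y z : S (x^-1 * y) -> S (y^-1 * z) -> S (x^-1 * z).
  by move=> Sxy /(subgroupM sS Sxy); rewrite -mulgA mulVKg.
have S_sym x y : S (x^-1 * y) -> S (y^-1 * x).
  by move=> /(subgroupV sS); rewrite invgM invgK.
(* [c h] numbers the coset of [h] by its first representative in the list;
   the numbers that occur form the finite type [X] acted upon. *)
pose rep h a := `[< S (a^-1 * h) >].
have has_rep h : has (rep h) s.
  by have [a sa Sa] := sP h I; apply/hasP; exists a => //; apply/asboolP.
have lt_c h : (find (rep h) s < size s)%N by rewrite -has_find.
pose c h := Ordinal (lt_c h).
have cP x y : c x = c y <-> S (x^-1 * y).
  have nthc h : S ((nth 1 s (c h))^-1 * h) by apply/asboolP/(nth_find 1 (has_rep h)).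
  split=> [cxy|Sxy].
    by apply: (S_trans _ (nth 1 s (c x))); [exact/S_sym|rewrite cxy].
  apply: val_inj => /=; apply: eq_find => a; apply/asboolP/asboolP => Sa.
    exact: S_trans Sa Sxy.
  by apply: S_trans Sa _; exact: S_sym.
pose X : finType := {i : 'I_(size s) | `[< exists h, c h = i >]}.
have Xc h : `[< exists h', c h' = c h >] by apply/asboolP; exists h.
pose cX h : X := exist _ (c h) (Xc h).
have cXP x y : cX x = cX y <-> S (x^-1 * y).
  rewrite -cP; split=> [[] eq_c|eq_c]; first exact: val_inj.
  by rewrite /cX; move: (Xc x); rewrite eq_c => Xcx; congr exist; exact: bool_irrelevance.
have /choice [r rP] : forall i : X, exists h, cX h = i.
  case=> i pi; have /asboolP [h hi] := pi; exists h.
  rewrite /cX; move: (Xc h); rewrite hi => pi'.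
  by congr exist; exact: bool_irrelevance.
pose act g i := cX (g^-1 * r i).
have act_inj g : injective (act g).
  move=> i j /cXP; rewrite invgM invgK !mulgA mulgK => /cXP.
  by rewrite !rP.
have fM : {morph (fun g => perm (@act_inj g)) : x y / x * y}.
  move=> x y; apply/permP => i; rewrite permM !permE; apply/cXP.
  rewrite !invgM !invgK !mulgA mulgK.
  have /cXP : cX (x^-1 * r i) = cX (r (act x i)) by rewrite rP.
  by rewrite invgM invgK.
exists {perm X}, (multiplicative_of fM) => x /=; split.
  move=> /permP /(_ (cX 1)); rewrite perm1 permE => /esym.
  rewrite -{1}(rP (cX 1)) => /cXP.
  move=> /(nS _ (r (cX 1))^-1).
  rewrite conjgE invgK !mulgA mulgV mul1g mulgK => /(subgroupV sS).
  by rewrite invgK.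
move=> Sx; apply/permP => i; rewrite perm1 permE -[RHS]rP.
apply/cXP; rewrite invgM invgK -mulgA.
exact: nS.
Qed.

Lemma invariant_quotient (G : groupType) (phi : automorphism G) (S : set G) :
  is_subgroup S -> (forall x g, S x -> S (x ^ g)) -> finite_mod setT S ->
  (forall x, S x <-> S (phi x)) ->
  exists (Q : finGroupType) (q : {multiplicative G -> Q})
    (phibar : automorphism Q),
    [/\ set_surj [set: G] [set: Q] q, forall g, q (phi g) = phibar (q g)
      & forall x, q x = 1 <-> S x].
Proof.
move=> sS nS finS phiS.
have [F [f fP]] := coset_quotient sS nS finS.
have [Q [q [iota [qsurj iota_inj qf]]]] := image_quotient f.
have qP x : q x = 1 <-> S x.
  by rewrite -fP -qf; split=> [->|/esym]; [exact: mult1|rewrite -(@mult1 _ _ iota) => /iota_inj].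
have [phibar phibarP] : exists phibar : automorphism Q, forall g, q (phi g) = phibar (q g).
  by apply: induced_automorphism => // x; rewrite !qP.
by exists Q, q, phibar.
Qed.

Section TwistedConj.
Variables (G : groupType) (phi : automorphism G).

Lemma twisted_conj_refl x : twisted_conj phi x x.
Proof. by exists 1; rewrite invg1 mult1 mul1g mulg1. Qed.

Lemma twisted_conj_sym x y : twisted_conj phi x y -> twisted_conj phi y x.
Proof.
move=> [g ->]; exists g^-1.
by rewrite invgK !mulgA mulVg mul1g -mulgA -gmulfM mulVg mult1 mulg1.
Qed.

Lemma twisted_conj_trans x y z :
  twisted_conj phi x y -> twisted_conj phi y z -> twisted_conj phi x z.
Proof.
by move=> [g ->] [h ->]; exists (h * g); rewrite invgM gmulfM !mulgA.
Qed.

Lemma twisted_conj_image x : twisted_conj phi x (phi x).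
Proof. by exists x^-1; rewrite invgK mulVg mul1g. Qed.

Lemma twisted_conj_aut_expz x k : twisted_conj phi x (aut_expz phi k x).
Proof.
elim: k => [|k IH|k IH]; first exact: twisted_conj_refl.
- apply: (twisted_conj_trans IH).
  by rewrite -addn1 PoszD aut_expzS; exact: twisted_conj_image.
- apply: (twisted_conj_trans IH); apply: twisted_conj_sym.
  rewrite -(subrK 1%R (- (k : int))%R) aut_expzS -addn1 PoszD opprD.
  exact: twisted_conj_image.
Qed.

End TwistedConj.

(** In the semidirect product, with [t] the generator of the integers,
    [x * t] and [y * t] are conjugate exactly when [x] and [y] are twisted
    conjugate: conjugation by [g] sends [x * t] to
    [g * x * (phi g)^-1 * t], and conjugation by [t] sends it to
    [phi x * t], where [phi x] is twisted conjugate to [x]. *)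
Lemma conjugacy_separable_semidirectZ (G : groupType) (phi : automorphism G) :
  conjugacy_separable (semidirectZ phi) -> twisted_conjugacy_separable phi.
Proof.
move=> csep x y nxy.
pose t : semidirectZ phi := (1, 1%R).
pose emb (g : G) : semidirectZ phi := (g, 0%R).
have embM : {morph emb : u v / u * v} by [].
have emb_t g : emb g * t = (g, 1%R) by rewrite /emb [LHS]/(_ * _) /= /sdZ_mul /= mulg1 add0r.
have t_emb g : t * emb g = emb (phi g) * t.
  by rewrite emb_t [LHS]/(_ * _) /= /sdZ_mul /= mul1g addr0.
have ncong : ~ Defs.conjugate (emb x * t) (emb y * t).
  move=> [[u n] /(congr1 (fun z : semidirectZ phi => ((u, n) : semidirectZ phi) * z))].
  rewrite conjgE mulVKg !emb_t => -[].
  rewrite /= => eqxy _; apply: nxy.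
  apply: (twisted_conj_trans _ (twisted_conj_sym (twisted_conj_aut_expz phi y n))).
  by exists u^-1; rewrite invgK -mulgA -eqxy mulKg.
have [F [q0 [_ nq0]]] := csep _ _ ncong.
have fM : {morph (fun g => q0 (emb g)) : u v / u * v}.
  by move=> u v; rewrite embM gmulfM.
have [Q [q [iota [qsurj iota_inj qf]]]] := image_quotient (multiplicative_of fM).
have fphi g : q0 (emb (phi g)) = q0 t * q0 (emb g) * (q0 t)^-1.
  by rewrite -gmulfM t_emb gmulfM mulgK.
have q1 g : q g = 1 <-> q0 (emb g) = 1.
  rewrite -[q0 _]/(multiplicative_of fM g) -qf.
  by split=> [->|/esym]; [exact: mult1|rewrite -(@mult1 _ _ iota) => /iota_inj].
have [phibar phibarP] : exists phibar : automorphism Q,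
    forall g, q (phi g) = phibar (q g).
  apply: induced_automorphism => // g; rewrite !q1 fphi; split=> [->|].
    by rewrite mulg1 mulgV.
  by move=> /divg1_eq /(canRL (mulKg _)) ->; rewrite mulVg.
exists Q, q, phibar; split=> // -[g].
have [u _ <-] := qsurj g I; rewrite -multV -phibarP -!gmulfM.
move=> /(congr1 iota); rewrite !qf /= => eqf; apply: nq0.
exists (q0 (emb u^-1)); rewrite gmulfM eqf !embM !gmulfM fphi conjgE.
have q0V : q0 (emb u) = (q0 (emb u^-1))^-1.
  by apply: (@mulIg _ (q0 (emb u^-1))); rewrite mulVg -gmulfM -embM mulgV; exact: mult1.
by rewrite q0V !mulgA mulgVK.
Qed.

End Quotients.

(** * Fully invariant subgroups *)

Section FullyInvariant.
Local Open Scope group_scope.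
Variable G : groupType.
Implicit Types (x y g h a b : G) (H K N S T : set G) (m n : nat).

Definition fully_invariant H :=
  is_subgroup H /\
  forall f : G -> G, {morph f : x y / x * y} -> forall x, H x -> H (f x).

Lemma fully_invariantJ H x g : fully_invariant H -> H x -> H (x ^ g).
Proof. by case=> _ HI Hx; apply: (HI (conjg^~ g)) => //; exact: conjg_morph. Qed.

Lemma fully_invariant_aut H (phi : automorphism G) x :
  fully_invariant H -> H x <-> H (phi x).
Proof.
case=> _ HI; split; first by apply: HI; exact: gmulfM.
by rewrite -{2}(aut_morK phi x); apply: HI; exact: aut_invM.
Qed.

Lemma fully_invariant_powers n : fully_invariant (powers n [set: G]).
Proof.
split; first exact: powers_subgroup.
by move=> f fM; exact: powers_morph.
Qed.

Definition commutators H : set G :=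
  generated [set z | exists x y, [/\ H x, H y & z = [~ x, y]]].

Lemma commutatorsR H x y : H x -> H y -> commutators H [~ x, y].
Proof. by move=> Hx Hy; apply: sub_generated; exists x, y. Qed.

Lemma fully_invariant_commutators H :
  fully_invariant H -> fully_invariant (commutators H).
Proof.
move=> [sH HI]; split; first exact: generated_subgroup.
move=> f fM; apply: generated_morph => // _ [x [y [Hx Hy ->]]].
have fV u : f u^-1 = (f u)^-1 by exact: (multV (multiplicative_of fM)).
rewrite /commg /conjg !fM !fV; apply: commutatorsR; exact: HI.
Qed.

Lemma commutators_sub H K :
  is_subgroup K -> (forall x y, H x -> H y -> K [~ x, y]) -> commutators H `<=` K.
Proof.
by move=> sK HK; apply: generated_sub => // _ [x [y [Hx Hy ->]]]; exact: HK.
Qed.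

Lemma subgroupR H x y : is_subgroup H -> H x -> H y -> H [~ x, y].
Proof.
move=> sH Hx Hy; rewrite /commg /conjg.
by do ?[apply: (subgroupM sH) => // | apply: (subgroupV sH) => //].
Qed.

Lemma fully_invariant_mul H K : fully_invariant H -> fully_invariant K ->
  fully_invariant [set z | exists x y, [/\ H x, K y & z = x * y]].
Proof.
move=> fH fK; have [sH HI] := fH; have [sK KI] := fK; split; first split.
- by exists 1, 1; rewrite mulg1; split=> //; exact: subgroup1.
- move=> _ _ [x [y [Hx Ky ->]]] [u [v [Hu Kv ->]]].
  exists (x * u), (y ^ u * v); split; first exact: (subgroupM sH).
    by apply: (subgroupM sK) => //; exact: fully_invariantJ.
  by rewrite conjgE !mulgA mulgK.
- move=> _ [x [y [Hx Ky ->]]].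
  exists x^-1, (y^-1 ^ x^-1); split; first exact: (subgroupV sH).
    by apply: fully_invariantJ => //; exact: (subgroupV sK).
  by rewrite invgM conjgE invgK !mulgA mulVg mul1g.
move=> f fM _ [x [y [Hx Ky ->]]]; exists (f x), (f y); rewrite fM.
by split=> //; [exact: HI|exact: KI].
Qed.

(** Degrees along the cyclic factor add up, so a commutator has degree 0. *)
Lemma commutators_cyclic_factor H K : is_subgroup H -> is_subgroup K ->
  normal_in K H -> cyclic_factor K H -> commutators H `<=` K.
Proof.
move=> sH sK nKH [a Ha Hcyc]; apply: commutators_sub => // x y Hx Hy.
have [i Kx] := Hcyc x Hx; have [j Ky] := Hcyc y Hy.
have -> : [~ x, y] = x^-1 * y^-1 * (x * y) by rewrite /commg /conjg !mulgA.
rewrite -(coset_deg0 K a) (_ : 0%R = (- i - j + (i + j))%R); last first.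
  by rewrite -opprD addNr.
have [HVx HVy] := (subgroupV sH Hx, subgroupV sH Hy).
apply: (coset_degM sH sK nKH Ha); try exact: (subgroupM sH).
  by apply: (coset_degM sH sK nKH Ha) => //; exact: (coset_degV sH sK nKH Ha).
exact: (coset_degM sH sK nKH Ha).
Qed.

Lemma polycyclic_solvable N K0 : polycyclic N -> K0 `<=` N ->
  exists d, iter d commutators K0 `<=` [set 1].
Proof.
move=> [d [s [s0 sd sub fac]]] K0N; exists d; rewrite -sd.
suff : forall i, (i <= d)%N -> iter i commutators K0 `<=` s i by apply.
elim=> [|i IH] le_id; first by rewrite s0.
have [nor cyc] := fac i le_id.
move=> x Kx; apply: (commutators_cyclic_factor (sub i (ltnW le_id)) (sub _ le_id) nor cyc).
move: x Kx; apply: commutators_sub; first exact: generated_subgroup.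
by move=> x y Kx Ky; apply: commutatorsR; exact: IH (ltnW le_id) _ _.
Qed.

Lemma finite_index_mod N : is_subgroup N -> finite_index N -> finite_mod setT N.
Proof.
move=> sN /finite_seqP [s sE].
exists [seq xget 1 A | A <- s] => h _.
have : range (fun g => [set g * k | k in N]) [set h * k | k in N] by exists h.
rewrite sE /= => hs; exists (xget 1 [set h * k | k in N]); first exact: map_f.
have : [set h * k | k in N] h by exists 1; rewrite ?mulg1 //; exact: subgroup1.
move=> /(xgetI 1) [k Nk <-].
by rewrite invgM mulgVK; exact: subgroupV.
Qed.

(** Openness of [S] for the topology that [H] inherits from [N]: each of the
    finitely many cosets other than [S] is kept away by separability. *)
Lemma polycyclic_open N H S : polycyclic N -> is_subgroup N -> is_subgroup S ->
  S `<=` N -> H `<=` N -> finite_mod H S ->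
  exists2 n, (0 < n)%N & forall x, powers n N x -> H x -> S x.
Proof.
move=> pN sN sS SN HN [s sP].
have /choice [f fP] : forall r, exists n, (0 < n)%N /\
    (N r -> (forall p, powers n N p -> ~ S (p^-1 * r)) \/ S r).
  move=> r; have [Nr|nNr] := pselect (N r); last by exists 1%N.
  have [Sr|nSr] := pselect (S r); first by exists 1%N; split=> // _; right.
  have : ~ forall n, (0 < n)%N -> exists2 p, powers n N p & S (p^-1 * r).
    by move=> /(polycyclic_separable pN sS SN Nr).
  move=> /existsNP [n /not_implyP [n_gt0 nex]]; exists n; split=> // _; left.
  by move=> p Pp Spr; apply: nex; exists p.
pose n := (\prod_(r <- s) f r)%N.
exists n; first by rewrite /n; apply: prodn_gt0 => r; exact: (fP r).1.
move=> x Px Hx; have [r sr Srx] := sP x Hx.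
have Nr : N r.
  have := subgroupM sN (HN _ Hx) (subgroupV sN (SN _ Srx)).
  by rewrite invgM invgK mulKVg.
have [far|Sr] := (fP r).2 Nr; last first.
  by rewrite -(mulVKg r x); exact: (subgroupM sS).
case: (far x); last by have := subgroupV sS Srx; rewrite invgM invgK.
move: Px; rewrite /n (perm_big _ (perm_to_rem sr)) big_cons.
exact: powersMl.
Qed.

End FullyInvariant.

(** * The Lang map of an almost polycyclic group *)

Section AlmostPolycyclic.
Local Open Scope group_scope.

(** Right translation by [z] carries the twisted classes of [twist phi z] to
    those of [phi]; this reduces the class of [z] to the class of 1. *)
Section Twist.
Variables (G : groupType) (phi : automorphism G) (z : G).

Let f g := z * phi g * z^-1.
Let f' g := aut_inv phi (z^-1 * g * z).

Lemma twistM : {morph f : x y / x * y}.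
Proof. by move=> x y; rewrite /f gmulfM !mulgA mulgVK. Qed.

Lemma twistK : cancel f f'.
Proof. by move=> g; rewrite /f' /f !mulgA mulVg mul1g mulgVK aut_morK. Qed.

Lemma twistK' : cancel f' f.
Proof. by move=> g; rewrite /f' /f aut_invK !mulgA mulgV mul1g mulgK. Qed.

Definition twist : automorphism G :=
  @Automorphism G (multiplicative_of twistM) f' twistK twistK'.

Lemma twistE g : twist g = z * phi g * z^-1. Proof. by []. Qed.

End Twist.

(** The form in which the finiteness of either number is used. *)
Definition bounded_twisted_classes (G : groupType) (phi : automorphism G) M :=
  forall (Q : finGroupType) (q : {multiplicative G -> Q}) (phibar : automorphism Q),
    set_surj [set: G] [set: Q] q -> (forall g, q (phi g) = phibar (q g)) ->
    forall k (x : 'I_k -> Q), twisted_free phibar x -> (k <= M)%N.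

Section LangMap.
Variables (G : groupType) (psi : automorphism G).
Implicit Types (x y g h a b : G) (H K P N S T : set G) (m n : nat).

(** The values of the Lang map form the twisted class of 1. *)
Definition lang b := b * (psi b)^-1.

Definition lang_set P T : set G :=
  [set z | exists b t, [/\ P b, T t & z = lang b * t]].

Section Modulo.
Variables H T : set G.
Hypotheses (fH : fully_invariant H) (fT : fully_invariant T).
Hypothesis HT : forall x y, H x -> H y -> T [~ x, y].

Let sH : is_subgroup H := fH.1.
Let sT : is_subgroup T := fT.1.

Lemma lang_in b : H b -> H (lang b).
Proof.
move=> Hb; apply: (subgroupM sH) => //; apply: (subgroupV sH).
exact: (fully_invariant_aut psi b fH).1.
Qed.

(** The Lang map is multiplicative modulo [T], because [H] is abelian there. *)
Lemma langM b c : H b -> H c ->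
  exists2 t, T t & lang b * lang c = lang (b * c) * t.
Proof.
move=> Hb Hc; have Hpb : H (psi b) by exact: (fully_invariant_aut psi b fH).1.
exists [~ (psi b)^-1, lang c].
  by apply: HT; [exact: (subgroupV sH)|exact: lang_in].
rewrite /lang gmulfM /commg /conjg.
by rewrite !(invgM, invgK, mulgA, mulgK, mulgVK).
Qed.

Lemma lang_setM P z w : P `<=` H -> is_subgroup P ->
  lang_set P T z -> lang_set P T w -> lang_set P T (z * w).
Proof.
move=> PH sP [b [t [Pb Tt ->]]] [c [u [Pc Tu ->]]].
have [v Tv bc] := langM (PH _ Pb) (PH _ Pc).
exists (b * c), (v * t ^ lang c * u); split; first exact: (subgroupM sP).
  apply: (subgroupM sT) => //; apply: (subgroupM sT) => //.
  exact: fully_invariantJ.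
by rewrite conjgE !mulgA -bc !(mulgA, mulgK).
Qed.

Lemma lang_set_subgroup P : P `<=` H -> is_subgroup P -> is_subgroup (lang_set P T).
Proof.
move=> PH sP.
have l1 : lang 1 = 1 by rewrite /lang mult1 mulgV.
have TV := subgroupV sT.
split; last 1 first.
- move=> _ [b [t [Pb Tt ->]]].
  have PbV := subgroupV sP Pb.
  have [u Tu] := langM (PH _ PbV) (PH _ Pb).
  rewrite mulVg l1 mul1g => lu.
  have lV : (lang b)^-1 = u^-1 * lang b^-1 by rewrite -lu [(_ * lang b)^-1]invgM mulgVK.
  exists b^-1, ((t^-1 * u^-1) ^ lang b^-1); split=> //.
    apply: fully_invariantJ => //.
    by apply: (subgroupM sT); exact: TV.
  by rewrite conjgE mulVKg [LHS]invgM lV mulgA.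
- by exists 1, 1; rewrite l1 mulg1; split=> //; exact: subgroup1.
- by move=> z w; exact: lang_setM.
Qed.

Lemma langX b t m : H b -> T t -> exists2 u, T u & (lang b * t) ^+ m = lang (b ^+ m) * u.
Proof.
move=> Hb Tt; elim: m => [|m [u Tu IH]].
  by exists 1; rewrite ?mulg1 ?expg0 /lang ?mult1 ?mulgV //; exact: subgroup1.
have [v Tv bc] := langM (subgroupX m sH Hb) Hb.
exists (v * u ^ lang b * t).
  apply: (subgroupM sT) => //; apply: (subgroupM sT) => //.
  exact: fully_invariantJ.
by rewrite expgSr IH (expgSr b) conjgE !mulgA -bc !(mulgA, mulgK).
Qed.

End Modulo.
End LangMap.

Section Separation.
Variables (G : groupType) (phi : automorphism G) (M c : nat) (z : G) (N : set G).
Implicit Types (x y g h a b : G) (H K P S T : set G) (m n : nat).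
Hypothesis bM : bounded_twisted_classes phi M.
Hypothesis cP : forall (Q : finGroupType) (phi : automorphism Q),
    (forall k (x : 'I_k -> Q), twisted_free phi x -> (k <= M)%N) ->
    forall z : Q, (#|[set r | (r * z == z * phi r)%g]%SET| <= c)%N.
Hypotheses (sN : is_subgroup N) (pN : polycyclic N) (finN : finite_mod setT N).

Let psi := twist phi z.

Lemma finite_index_powers n : (0 < n)%N -> finite_mod [set: G] (powers n [set: G]).
Proof.
move=> n_gt0; have fin := polycyclic_finite_mod_powers n_gt0 pN.
by apply: (finite_modS (finite_mod_trans finN fin)) => //; exact: powersS.
Qed.

Lemma powers_open n : (0 < n)%N ->
  exists2 n', (0 < n')%N & powers n' [set: G] `<=` powers n N.
Proof.
move=> n_gt0; apply: finite_mod_powers; [exact: subgroupT|exact: powers_subgroup|].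
by apply: finite_mod_trans finN _; exact: polycyclic_finite_mod_powers.
Qed.

Section Layer.
Variables H T : set G.
Hypotheses (fH : fully_invariant H) (fT : fully_invariant T) (HN : H `<=` N).
Hypothesis HT : forall x y, H x -> H y -> T [~ x, y].
Hypothesis TH : T `<=` H.

Let sH : is_subgroup H := fH.1.
Let sT : is_subgroup T := fT.1.

(** In each finite quotient the image of [H] modulo [T] is abelian, and there
    the index of the image of the Lang map is the number of fixed points, which
    is at most [c].  So the [c`!]-th powers lie in that image for every
    quotient at once, and separability lifts this to [G]. *)
Lemma lang_set_exponent a : H a -> lang_set psi H T (a ^+ c`!).
Proof.
move=> Ha.
have HaX : H (a ^+ c`!) by exact: subgroupX.
have sL : is_subgroup (lang_set psi H T).
  exact: (lang_set_subgroup psi fH fT HT (@subset_refl _ H) sH).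
have LH : lang_set psi H T `<=` H.
  move=> _ [b [t [Hb Tt ->]]].
  by apply: (subgroupM sH); [exact: lang_in|exact: TH].
apply: (polycyclic_separable pN sL) => [x /LH /HN //||n n_gt0]; first exact: HN.
have [n' n'_gt0 nn'] := powers_open n_gt0.
pose U : set G := [set w | exists x y, [/\ powers n' setT x, T y & w = x * y]].
have fU : fully_invariant U by apply: fully_invariant_mul => //; exact: fully_invariant_powers.
have [|Q [q [phibar [qsurj qphi qU]]]] := invariant_quotient (phi := phi) fU.1
    (fun x g => @fully_invariantJ _ _ _ _ fU) _ (fun x => fully_invariant_aut phi x fU).
  apply: (finite_modS (finite_index_powers n'_gt0)) => //.
  by move=> g Pg; exists g, 1; rewrite mulg1; split=> //; exact: subgroup1.
pose psibar := twist phibar (q z).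
have qpsi g : q (psi g) = psibar (q g) by rewrite !twistE !gmulfM qphi multV.
pose A : {set Q} := [set r | `[< exists2 x, H x & q x = r >]]%SET.
have AP r : reflect (exists2 x, H x & q x = r) (r \in A).
  by rewrite inE; exact: asboolP.
have gA : group_set A.
  apply/group_setP; split; first by apply/AP; exists 1; [exact: subgroup1|exact: mult1].
  move=> _ _ /AP [u Hu <-] /AP [v Hv <-]; apply/AP.
  by exists (u * v); [exact: (subgroupM sH)|rewrite gmulfM].
pose AG := Group gA.
have abA : abelian AG.
  apply/centsP => _ /AP [u Hu <-] _ /AP [v Hv <-].
  rewrite /commute -!gmulfM (commgC u v) gmulfM.
  have /qU -> : U [~ u, v].
    by exists 1, [~ u, v]; rewrite mul1g; split=> //; [exact: (subgroup1 (powers_subgroup _ _))|exact: HT].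
  by rewrite mulg1.
have psiA r : r \in AG -> psibar r \in AG.
  move=> /AP [u Hu <-]; apply/AP; exists (psi u); last exact: qpsi.
  exact: (fully_invariant_aut psi u fH).1.
have fixc : (#|[set r | psibar r == r]%SET| <= c)%N.
  have := cP (@bM _ _ _ qsurj qphi) (q z); apply: leq_trans.
  apply: subset_leq_card; apply/fintype.subsetP => g; rewrite !inE twistE.
  by move=> /eqP gz; rewrite -{1}gz mulgVK.
have qaA : q a \in AG by apply/AP; exists a.
have [_ /AP [b Hb <-]] := lang_map_exponent abA psiA fixc qaA.
rewrite -qpsi -multV -gmulfM -multX => /esym qab.
have : U ((lang psi b)^-1 * a ^+ c`!).
  by apply/qU; rewrite gmulfM multV qab mulVg.
move=> [x [y [Px Ty xy]]]; exists (x ^ (lang psi b)^-1).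
  by apply: nn'; apply: (@fully_invariantJ _ (powers n' setT)) => //; exact: fully_invariant_powers.
exists b, y; split=> //.
rewrite -(mulVKg (lang psi b) (a ^+ _)) xy; move: (lang psi b) => L.
by rewrite conjgE !(invgM, invgK, mulgA, mulgK, mulgVK).
Qed.

(** The values at the [m]-th powers contain the [c`! * m]-th powers of [H], so
    they form a subgroup of finite index, hence an open one. *)
Lemma lang_set_open m : (0 < m)%N ->
  exists2 n, (0 < n)%N & forall x, powers n setT x -> H x ->
    lang_set psi (H `&` powers m setT) T x.
Proof.
move=> m_gt0; set P := _ `&` _.
have sP : is_subgroup P by apply: subgroupI => //; exact: powers_subgroup.
have PH : P `<=` H by exact: subIsetl.
have sL := lang_set_subgroup psi fH fT HT PH sP.
have LH : lang_set psi P T `<=` H.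
  move=> _ [b [t [/PH Hb Tt ->]]].
  by apply: (subgroupM sH); [exact: lang_in|exact: TH].
have pH : polycyclic H by exact: polycyclic_sub pN.
have finH : finite_mod H (lang_set psi P T).
  have e_gt0 : (0 < c`! * m)%N by rewrite muln_gt0 fact_gt0.
  apply: (finite_modS (polycyclic_finite_mod_powers e_gt0 pH)) => //.
  apply: powers_sub => // a Ha.
  have [b [t [Hb Tt ab]]] := lang_set_exponent Ha.
  have [u Tu bu] := langX psi fH fT HT m Hb Tt.
  rewrite expgnA ab bu; exists (b ^+ m), u; split=> //; split; first exact: subgroupX.
  exact: powersX.
have [n n_gt0 nP] := polycyclic_open pN sN sL (fun x Lx => HN (LH x Lx)) HN finH.
have [n' n'_gt0 nn'] := powers_open n_gt0.
by exists n' => // x /nn'; exact: nP.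
Qed.

End Layer.

(** Openness at 1 of the Lang map of [G / K]. *)
Let modulo K := forall m, (0 < m)%N -> exists2 n, (0 < n)%N &
  forall x, powers n setT x -> exists2 l, powers m setT l & K (l^-1 * x * psi l).

(** The Lang map is open modulo [K]: descending one layer, the error left by
    the previous layer is small, hence itself the value of the Lang map at a
    small element, up to the next layer. *)
Lemma lang_open_step K : fully_invariant K -> K `<=` N ->
  modulo K -> modulo (commutators K).
Proof.
move=> fK KN IH m m_gt0.
have fT := fully_invariant_commutators fK.
have TK : commutators K `<=` K.
  by apply: commutators_sub; [exact: fK.1|move=> x y; exact: (subgroupR fK.1)].
have [n0 n0_gt0 n0P] := lang_set_open fK fT KN (@commutatorsR _ K) TK m_gt0.
have m1_gt0 : (0 < m * n0)%N by rewrite muln_gt0 m_gt0.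
have [n1 n1_gt0 n1P] := IH _ m1_gt0.
exists (n1 * (m * n0))%N; first by rewrite muln_gt0 n1_gt0.
move=> x Px; have [l Pl Kl] := n1P x (powersMl (subgroupT G) Px).
have sP := powers_subgroup (m * n0) [set: G].
have Ph : powers (m * n0) setT (l^-1 * x * psi l).
  apply: (subgroupM sP); last first.
    exact: (fully_invariant_aut psi l (fully_invariant_powers G _)).1.
  by apply: (subgroupM sP); [exact: (subgroupV sP)|exact: (powersMr (subgroupT G) Px)].
have [b [t [[Kb Pb] Tt e]]] := n0P _ (powersMr (subgroupT G) Ph) Kl.
exists (l * b).
  apply: (subgroupM (powers_subgroup _ _)) => //; exact: (powersMl (subgroupT G) Pl).
have -> : (l * b)^-1 * x * psi (l * b) = b^-1 * (l^-1 * x * psi l) * psi b.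
  by rewrite gmulfM invgM !mulgA.
have -> : b^-1 * (l^-1 * x * psi l) * psi b = t ^ psi b.
  by rewrite e /lang; move: (psi b) => pb; rewrite !mulgA mulVg mul1g -mulgA.
exact: (fully_invariantJ _ fT).
Qed.

Lemma lang_open : exists2 n, (0 < n)%N &
  forall g, powers n setT g -> exists l, g = lang psi l.
Proof.
have [m0 m0_gt0 m0N] := finite_mod_powers (subgroupT G) sN finN.
pose K d := iter d (@commutators G) (powers m0 setT).
have fK d : fully_invariant (K d).
  elim: d => [|d IH]; first exact: fully_invariant_powers.
  exact: fully_invariant_commutators.
have KN d : K d `<=` N.
  elim: d => [|d IH] //=.
  by apply: commutators_sub => // x y /IH Nx /IH Ny; exact: subgroupR.
have [d Kd] := polycyclic_solvable pN m0N.
have modK i : modulo (K i).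
  elim: i => [m m_gt0|i IH]; last exact: lang_open_step.
  exists m0 => // x Px; exists 1; first exact: (subgroup1 (powers_subgroup _ _)).
  by rewrite mult1 invg1 mul1g mulg1.
have [n n_gt0 nP] := modK d 1%N isT; exists n => // g /nP [l _ /Kd /= lg].
exists l; rewrite /lang.
apply: (@mulIg _ (psi l)); rewrite mulgVK; apply: (@mulgI _ l^-1).
by rewrite mulVg mulgA lg.
Qed.

End Separation.

(** Openness of the Lang map of [twist phi x] says that the class of [x] contains
    a coset of some [powers n setT]; modulo this subgroup no other class meets
    it. *)
Lemma almost_polycyclic_separable (G : groupType) (phi : automorphism G) M :
  almost_polycyclic G -> bounded_twisted_classes phi M ->
  twisted_conjugacy_separable phi.
Proof.
move=> [N [sN _ pN iN]] bM x y nxy.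
have finN := finite_index_mod sN iN.
have [c cP] := stabilizer_bound M.
have [n n_gt0 nP] := lang_open x bM cP sN pN finN.
have fP := fully_invariant_powers G n.
have [Q [q [phibar [qsurj qphi qP]]]] := invariant_quotient (phi := phi) fP.1
  (fun x g => @fully_invariantJ _ _ _ _ fP)
  (finite_index_powers pN finN n_gt0)
  (fun x => fully_invariant_aut phi x fP).
exists Q, q, phibar; split=> // -[h'].
have [h _ <-] := qsurj h' I; rewrite -multV -qphi -!gmulfM => qy.
apply: nxy; set w := h * x * phi h^-1 in qy.
have [l lE] : exists l, ((w^-1 * y) ^ phi h) ^ x^-1 = lang (twist phi x) l.
  have Pg : powers n setT (w^-1 * y) by apply/qP; rewrite gmulfM multV qy mulVg.
  exact: (nP _ (fully_invariantJ _ fP (fully_invariantJ _ fP Pg))).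
have wy : w^-1 * y = (lang (twist phi x) l ^ x) ^ (phi h)^-1.
  by rewrite -lE conjgKV conjgK.
exists (h * l); rewrite -(mulVKg w y) wy /w /lang twistE !multV gmulfM !conjgE.
by rewrite !(invgM, invgK, mulgA, mulgK, mulgVK).
Qed.

End AlmostPolycyclic.

(** * Subspaces and projectors of Hermitian spaces *)

Section Adjoints.
Local Open Scope ring_scope.
Local Open Scope sesquilinear_scope.

(** Take a subspace of largest dimension on which [P] holds: a further vector
    satisfying [P] would enlarge it. *)
Lemma vspace_of_pred (F : fieldType) (V : vectType F) (P : V -> Prop) :
  P 0 -> (forall a u v, P u -> P v -> P (a *: u + v)) ->
  exists W : {vspace V}, forall v, v \in W <-> P v.
Proof.
move=> P0 Plin.
pose pd d := `[< exists W : {vspace V}, (forall v, v \in W -> P v) /\ \dim W = d >].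
have exd : exists d, pd d.
  exists 0%N; apply/asboolP; exists 0%VS; rewrite dimv0; split=> // v.
  by rewrite memv0 => /eqP ->.
have ubd d : pd d -> (d <= \dim {: V})%N.
  by move=> /asboolP [W [_ <-]]; apply: dimvS; exact: subvf.
case: (ex_maxnP exd ubd) => d /asboolP [W [WP dW]] dmax.
exists W => v; split; first exact: WP.
move=> Pv; apply: contrapT => /negP nWv.
have : pd (\dim (W + <[v]>)%VS).
  apply/asboolP; exists (W + <[v]>)%VS; split=> // w /memv_addP [u Wu [x /vlineP [a ->] ->]].
  by rewrite addrC; apply: Plin => //; exact: WP.
move=> /dmax; rewrite -dW => le_d.
have := dimv_leqif_sup (addvSl W <[v]>); move=> [_]; rewrite eqn_leq le_d.
rewrite dimvS ?addvSl //= => /esym /subvP sW.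
by case/negP: nWv; apply: sW; apply: subvP (addvSr W <[v]>) _ (memv_line v).
Qed.

Variable C : numClosedFieldType.

Lemma adjM m n p (A : 'M[C]_(m, n)) (B : 'M[C]_(n, p)) :
  (A *m B)^t* = B^t* *m A^t*.
Proof. by rewrite trmx_mul map_mxM. Qed.

Lemma adjZ m n a (A : 'M[C]_(m, n)) : (a *: A)^t* = a^* *: A^t*.
Proof. by rewrite linearZ /= map_mxZ. Qed.

Lemma adj0 m n : (0 : 'M[C]_(m, n))^t* = 0.
Proof. by rewrite trmx0 map_mx0. Qed.

Lemma adj1 n : (1%:M : 'M[C]_n)^t* = 1%:M.
Proof. by rewrite trmx1 map_mx1. Qed.

Lemma eq_mulmx_col m n (A B : 'M[C]_(m, n)) :
  (forall v : 'cV_n, A *m v = B *m v) -> A = B.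
Proof.
move=> AB; apply/matrixP => i j.
by have := congr1 (fun M : 'cV_m => M i 0) (AB (delta_mx j 0)); rewrite -!colE !mxE.
Qed.

Lemma mxtrace_adj_eq0 m n (A : 'M[C]_(m, n)) : \tr (A *m A^t*) = 0 -> A = 0.
Proof.
move=> tr0; apply/matrixP => i j; rewrite mxE.
have sq_ge0 k l : 0 <= A k l * (A k l)^* by exact: mul_conjC_ge0.
have trE : \tr (A *m A^t*) = \sum_k \sum_l A k l * (A k l)^*.
  by apply: eq_bigr => k _; rewrite mxE; apply: eq_bigr => l _; rewrite !mxE.
have row0 : \sum_l A i l * (A i l)^* = 0.
  move: tr0; rewrite trE => /eqP; rewrite psumr_eq0 => [/allP /(_ i)|k _].
    by rewrite mem_index_enum => /(_ isT) /= /eqP.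
  by apply: sumr_ge0.
move: row0 => /eqP; rewrite psumr_eq0 => [/allP /(_ j)|//].
by rewrite mem_index_enum => /(_ isT) /=; rewrite mul_conjC_eq0 => /eqP.
Qed.

(** Orthonormal coordinates on a subspace: [B^t* *m B] is the orthogonal
    projector onto it. *)
Lemma orthonormal_coordinates n (W : {vspace 'cV[C]_n}) :
  exists k (B : 'M[C]_(k, n)),
    B \is unitarymx /\ forall v, v \in W <-> B^t* *m (B *m v) = v.
Proof.
pose M : 'M[C]_(\dim W, n) := \matrix_i ((vbasis W)`_i)^t*.
have rowM i : row i M = ((vbasis W)`_i)^t* by rewrite rowK.
have MP v : v \in W <-> (v^t* <= M)%MS.
  split=> [Wv|/submxP [D vD]].
    rewrite (coord_vbasis Wv) (_ : _^t* =
      \sum_i (coord (vbasis W) i v)^* *: row i M); last first.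
      rewrite linear_sum /= map_mx_sum /=; apply: eq_bigr => i _.
      by rewrite adjZ rowM.
    by apply: summx_sub => i _; apply: scalemx_sub; exact: row_sub.
  rewrite -(trmxCK v) vD mulmx_sum_row linear_sum /= map_mx_sum /=.
  apply: memv_suml => i _; rewrite adjZ rowM trmxCK memvZ // vbasis_mem //.
  by rewrite mem_nth // size_tuple.
pose B := schmidt (row_base M).
have BM : (B :=: M)%MS.
  by apply: eqmx_trans (eq_row_base M); apply: eqmx_schmidt_free; exact: row_base_free.
have uB : B \is unitarymx by apply: schmidt_unitarymx; exact: rank_leq_col.
exists _, B; split=> // v; rewrite MP -BM; split=> [/submxP [D vD]|<-].
  apply: (can_inj (@trmxCK _ _ _)); rewrite !adjM trmxCK vD.
  by rewrite -(mulmxA D) (unitarymxP uB) mulmx1.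
by rewrite adjM trmxCK submxMl.
Qed.

End Adjoints.

(** * Unitary representations and Schur's lemma *)

Section UnitaryReps.
Local Open Scope ring_scope.
Local Open Scope sesquilinear_scope.
Variables (R : realType) (G : groupType).
Local Notation C := (R[i]).
Local Notation rep := (unitary_rep R G).
Implicit Types rho sigma tau : rep.

Lemma rep_adj rho g : (rho g)^t* = rho g^-1%g.
Proof.
have e : rho g *m rho g^-1%g = 1%:M by rewrite -rep_mxM mulgV rep_mx1.
have := unitarymxP (rep_mx_unitary rho g) => u.
by rewrite -[LHS]mul1mx -(mulmx1C e) -mulmxA u mulmx1.
Qed.

Definition invariant rho (W : {vspace 'cV[C]_(rep_dim rho)}) :=
  forall (g : G) v, v \in W -> rho g *m v \in W.

(** With [P] the orthogonal projector, invariance says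
    [P *m rho g *m P = rho g *m P]; the adjoint of this identity for the inverse
    of [g] gives [P *m rho g]. *)
Lemma invariant_projector rho W : invariant W ->
  exists k (B : 'M[C]_(k, rep_dim rho)),
    [/\ B \is unitarymx, forall v, v \in W <-> B^t* *m (B *m v) = v
      & forall g, B^t* *m B *m rho g = rho g *m (B^t* *m B)].
Proof.
move=> invW; have [k [B [uB WB]]] := orthonormal_coordinates W.
exists k, B; split=> //; set P := B^t* *m B.
have Padj : P^t* = P by rewrite adjM trmxCK.
have half g : P *m rho g *m P = rho g *m P.
  apply: eq_mulmx_col => v.
  have WP : P *m v \in W.
    by apply/WB; rewrite /P !mulmxA -(mulmxA _ B (B^t*)) (unitarymxP uB) mulmx1.
  by have /WB := invW g _ WP; rewrite !mulmxA.
move=> g; clearbody P; have := congr1 (fun X : 'M_(rep_dim rho) => X^t*) (half g^-1%g).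
by rewrite /= !adjM rep_adj invgK Padj mulmxA half => ->.
Qed.

Section Subrep.
Variables (rho : rep) (k : nat) (B : 'M[C]_(k, rep_dim rho)).
Hypothesis uB : B \is unitarymx.
Hypothesis cB : forall g, B^t* *m B *m rho g = rho g *m (B^t* *m B).

Lemma subrep_mx1 : B *m rho 1%g *m B^t* = 1%:M.
Proof. by rewrite rep_mx1 mulmx1; exact: (unitarymxP uB). Qed.

Lemma subrep_mxM g h :
  B *m rho (g * h)%g *m B^t* = (B *m rho g *m B^t*) *m (B *m rho h *m B^t*).
Proof.
rewrite rep_mxM -!mulmxA; congr (B *m (rho g *m _)).
by rewrite !mulmxA cB -!mulmxA (unitarymxP uB) mulmx1.
Qed.

Lemma subrep_unitary g : B *m rho g *m B^t* \is unitarymx.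
Proof.
apply/unitarymxP; rewrite !adjM trmxCK rep_adj (mulmxA B) -subrep_mxM mulgV.
exact: subrep_mx1.
Qed.

Definition subrep : rep := UnitaryRep subrep_mx1 subrep_mxM subrep_unitary.

Lemma mxtrace_subrep A g :
  \tr (A *m (B^t* *m B) *m rho g) = \tr (B *m A *m B^t* *m subrep g).
Proof.
have PP : B^t* *m B *m (B^t* *m B) = B^t* *m B.
  by rewrite mulmxA -(mulmxA _ B (B^t*)) (unitarymxP uB) mulmx1.
have PrP : B^t* *m B *m rho g *m (B^t* *m B) = B^t* *m B *m rho g.
  by rewrite cB -[LHS]mulmxA PP.
rewrite -mulmxA -PrP /= (_ : A *m _ = A *m B^t* *m (B *m rho g *m B^t*) *m B).
  by rewrite mxtrace_mulC !mulmxA.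
by rewrite !mulmxA.
Qed.

End Subrep.

(** An invariant subspace and its orthogonal complement split a coefficient
    function into coefficients of two representations of smaller dimension.
    Quantifying over the closed sets [X] expresses the span of the irreducible
    coefficients without choosing a decomposition. *)
Lemma coefficient_ind (X : set (G -> C)) :
  X (fun=> 0) -> (forall f1 f2, X f1 -> X f2 -> X (fun g => f1 g + f2 g)) ->
  (forall rho A, irreducible_rep rho -> X (fun g => \tr (A *m rho g))) ->
  forall rho A, X (fun g => \tr (A *m rho g)).
Proof.
move=> X0 XD Xirr rho; have [n] := ubnP (rep_dim rho).
elim: n rho => // n IH rho; rewrite ltnS => le_n A.
have [irr|nirr] := pselect (irreducible_rep rho); first exact: Xirr.
case: (posnP (rep_dim rho)) => [d0|d_gt0].
  rewrite (_ : (fun g => _) = (fun=> 0)) //; apply/funext => g.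
  by rewrite /mxtrace big1 // => -[i lt_i]; exfalso; rewrite d0 in lt_i.
have [W [invW W0 WT]] : exists W, [/\ invariant W, W <> 0%VS :> {vspace _}
    & W <> fullv :> {vspace 'cV[C]_(rep_dim rho)}].
  apply: contrapT => noW; apply: nirr; split=> // W invW.
  apply: contrapT => /not_orP [W0 WT]; apply: noW; by exists W.
have [k [B [uB WB cB]]] := invariant_projector invW.
set P := B^t* *m B in cB.
have PP : P *m P = P by rewrite /P mulmxA -(mulmxA _ B (B^t*)) (unitarymxP uB) mulmx1.
have Padj : P^t* = P by rewrite /P adjM trmxCK.
have [W' W'P] : exists W' : {vspace 'cV[C]_(rep_dim rho)},
    forall v, v \in W' <-> P *m v = 0.
  apply: vspace_of_pred => [|a u v Pu Pv]; first by rewrite mulmx0.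
  by rewrite mulmxDr -scalemxAr Pu Pv scaler0 addr0.
have invW' : invariant W'.
  by move=> g v /W'P Pv; apply/W'P; rewrite mulmxA cB -mulmxA Pv mulmx0.
have [k' [B' [uB' WB' cB']]] := invariant_projector invW'.
set P' := B'^t* *m B' in cB'.
have PP' : P' *m P' = P' by rewrite /P' mulmxA -(mulmxA _ B' (B'^t*)) (unitarymxP uB') mulmx1.
have P'adj : P'^t* = P' by rewrite /P' adjM trmxCK.
have P0 : P *m P' = 0.
  apply: eq_mulmx_col => v; rewrite mul0mx -mulmxA; apply/W'P/WB'.
  by rewrite mulmxA -/P' mulmxA PP'.
have P'0 : P' *m P = 0.
  by apply: (can_inj (@trmxCK _ _ _)); rewrite adjM Padj P'adj P0 adj0.
have PP'1 : P + P' = 1%:M.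
  apply: eq_mulmx_col => v; rewrite mul1mx.
  have : v - P *m v \in W' by apply/W'P; rewrite mulmxBr mulmxA PP subrr.
  move=> /WB'; rewrite mulmxA -/P' mulmxBr mulmxA P'0 mul0mx subr0 mulmxDl => ->.
  by rewrite addrC subrK.
(* A representation of full dimension would make its projector the identity. *)
have small m (D : 'M[C]_(m, rep_dim rho)) : D \is unitarymx ->
    D^t* *m D <> 1%:M -> (m < rep_dim rho)%N.
  move=> uD nD; have := rank_leq_col D; rewrite mxrank_unitary // leq_eqVlt.
  case/orP => // /eqP md; case: nD; move: D uD; rewrite md => D uD.
  exact: (mulmx1C (unitarymxP uD)).
have Pn1 : P <> 1%:M.
  move=> P1; apply: WT; apply/vspaceP => v; rewrite memvf; apply/WB.
  by rewrite mulmxA -/P P1 mul1mx.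
have P'n1 : P' <> 1%:M.
  move=> P'1; apply: W0; apply/vspaceP => v; rewrite memv0.
  apply/idP/eqP => [/WB|->]; last exact: mem0v.
  rewrite mulmxA -/P (_ : P = 0) ?mul0mx //.
  by rewrite -[P]mulmx1 -P'1.
rewrite (_ : (fun g => _) = (fun g => \tr (B *m A *m B^t* *m subrep uB cB g) +
    \tr (B' *m A *m B'^t* *m subrep uB' cB' g))); last first.
  apply/funext => g; rewrite -!mxtrace_subrep -mxtraceD -mulmxDl -mulmxDr.
  by rewrite -/P -/P' PP'1 mulmx1.
apply: XD.
  by apply: (IH (subrep uB cB)); apply: leq_trans le_n; exact: (small _ _ uB Pn1).
by apply: (IH (subrep uB' cB')); apply: leq_trans le_n; exact: (small _ _ uB' P'n1).
Qed.

(** Schur's lemma: an eigenspace of [T] is invariant and non-zero. *)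
Lemma schur_scalar rho (T : 'M[C]_(rep_dim rho)) : irreducible_rep rho ->
  (forall g, T *m rho g = rho g *m T) -> exists a, T = a%:M.
Proof.
move=> [d_gt0 irr] cT.
have [a /eigenvalueP [v vT v0]] := eigenvalue_closed T^T d_gt0.
exists a.
have [W WP] : exists W : {vspace 'cV[C]_(rep_dim rho)},
    forall v, v \in W <-> T *m v = a *: v.
  apply: vspace_of_pred => [|b u w Pu Pw]; first by rewrite mulmx0 scaler0.
  by rewrite mulmxDr -scalemxAr Pu Pw scalerDr !scalerA mulrC.
have Wv : v^T \in W.
  by apply/WP; rewrite -[T]trmxK -trmx_mul vT linearZ.
have [|W0|WT] := irr W.
- by move=> g w /WP Tw; apply/WP; rewrite mulmxA cT -mulmxA Tw -scalemxAr.
- by move: Wv; rewrite W0 memv0 trmx_eq0 (negPf v0).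
apply: eq_mulmx_col => w; rewrite mul_scalar_mx; apply/WP.
by rewrite WT memvf.
Qed.

Lemma intertwiner_adj rho sigma (T : 'M[C]_(rep_dim sigma, rep_dim rho)) :
  (forall g, T *m rho g = sigma g *m T) ->
  forall g, T^t* *m sigma g = rho g *m T^t*.
Proof.
move=> cT g; have := congr1 (fun X : 'M_(_, _) => X^t*) (cT g^-1%g).
by rewrite !adjM !rep_adj !invgK.
Qed.

(** Both [T^t* *m T] and [T *m T^t*] are scalar by Schur's lemma, so dividing [T]
    by the square root of that scalar makes it unitary. *)
Lemma schur_equiv rho sigma (T : 'M[C]_(rep_dim sigma, rep_dim rho)) :
  irreducible_rep rho -> irreducible_rep sigma ->
  (forall g, T *m rho g = sigma g *m T) -> T != 0 -> equiv_rep rho sigma.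
Proof.
move=> irr_r irr_s cT T0.
have cT' := intertwiner_adj cT.
have [a aE] : exists a, T^t* *m T = a%:M.
  by apply: (schur_scalar irr_r) => g; rewrite -mulmxA cT mulmxA cT' mulmxA.
have [b bE] : exists b, T *m T^t* = b%:M.
  by apply: (schur_scalar irr_s) => g; rewrite -mulmxA cT' mulmxA cT mulmxA.
have ab : a = b.
  have : a *: T = b *: T.
    by rewrite -mul_mx_scalar -aE mulmxA bE mul_scalar_mx.
  move=> /eqP; rewrite -subr_eq0 -scalerBl scaler_eq0 (negPf T0) orbF subr_eq0.
  by move/eqP.
have b_ge0 : 0 <= b.
  have d_gt0 := irr_s.1.
  have := congr1 (fun X : 'M_(rep_dim sigma) => X (Ordinal d_gt0) (Ordinal d_gt0)) bE.
  rewrite !mxE eqxx mulr1n => <-; apply: sumr_ge0 => l _; rewrite !mxE.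
  exact: mul_conjC_ge0.
have b0 : b != 0.
  apply/eqP => b0; case/eqP: T0; apply: mxtrace_adj_eq0.
  by rewrite bE b0 raddf0 mxtrace0.
pose c := (sqrtC b)^-1.
have cc : c * c^* = b^-1.
  by rewrite geC0_conj ?invr_ge0 ?sqrtC_ge0 // /c -invfM -expr2 sqrtCK.
exists (c *: T); split.
- apply/unitarymxP; rewrite adjZ -scalemxAl -scalemxAr scalerA bE cc.
  by rewrite scale_scalar_mx mulVf.
- apply/unitarymxP; rewrite trmxCK adjZ -scalemxAl -scalemxAr scalerA aE ab mulrC cc.
  by rewrite scale_scalar_mx mulVf.
- by move=> g; rewrite -scalemxAl -scalemxAr cT.
Qed.

End UnitaryReps.

(** * Coefficient functions *)

Section Coefficients.
Local Open Scope ring_scope.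
Local Open Scope sesquilinear_scope.
Variables (R : realType) (G : groupType).
Local Notation C := (R[i]).
Local Notation rep := (unitary_rep R G).
Implicit Types rho sigma tau : rep.

Lemma mxdiagM m (p_ : 'I_m -> nat) (A B : forall i, 'M[C]_(p_ i)) :
  \mxdiag_i A i *m \mxdiag_i B i = \mxdiag_i (A i *m B i).
Proof.
apply: eq_mulmx_col => v; rewrite -(submxcolK v) -mulmxA !mul_mxdiag_mxcol.
by apply: eq_mxcol => i; rewrite mulmxA.
Qed.

Lemma adj_mxdiag m (p_ : 'I_m -> nat) (A : forall i, 'M[C]_(p_ i)) :
  (\mxdiag_i A i)^t* = \mxdiag_i (A i)^t*.
Proof.
rewrite tr_mxdiag; apply/matrixP => k l; rewrite !mxE.
case: eqP => _; last by rewrite !mxE rmorph0.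
by rewrite -[in RHS](map_mx0 Num.conj) -map_conform_mx mxE.
Qed.

Section DirectSum.
Variables (m : nat) (r : 'I_m -> rep).

Definition sum_mx (g : G) := \mxdiag_i (r i g).

Lemma sum_mx1 : sum_mx 1%g = 1%:M.
Proof.
by rewrite /sum_mx -mxdiagZ; apply: eq_mxdiag => i; rewrite rep_mx1.
Qed.

Lemma sum_mxM g h : sum_mx (g * h)%g = sum_mx g *m sum_mx h.
Proof. by rewrite /sum_mx mxdiagM; apply: eq_mxdiag => i; rewrite rep_mxM. Qed.

Lemma sum_mx_unitary g : sum_mx g \is unitarymx.
Proof.
apply/unitarymxP; rewrite adj_mxdiag mxdiagM -mxdiagZ.
by apply: eq_mxdiag => i; exact: (unitarymxP (rep_mx_unitary _ _)).
Qed.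

Definition sum_rep : rep := UnitaryRep sum_mx1 sum_mxM sum_mx_unitary.

Lemma sum_rep_commP (T : 'M[C]_(\sum_i rep_dim (r i)))
    (D : forall i, 'M[C]_(rep_dim (r i))) :
  T *m \mxdiag_i D i = \mxdiag_i D i *m T <->
  forall i j, submxblock T i j *m D j = D i *m submxblock T i j.
Proof.
rewrite -{1 2}(submxblockK T) mul_mxblock_mxdiag mul_mxdiag_mxblock.
by rewrite -eq_mxblockP.
Qed.

End DirectSum.

(** The bicommutant theorem, in dual form.  With [N] the dimension, the columns
    [X] of the [N]-fold sum of the representation are the square matrices, and
    those orthogonal to every [A] that annihilates the representation form an
    invariant subspace [W] containing the identity.  The projector onto [W]
    has its blocks in the commutant, so it commutes with the diagonal action of
    [B], and [B] lies in [W]. *)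
Lemma bicommutant rho (A B : 'M[C]_(rep_dim rho)) :
  (forall g, \tr (A *m rho g) = 0) ->
  (forall T, (forall g, T *m rho g = rho g *m T) -> T *m B = B *m T) ->
  \tr (A *m B) = 0.
Proof.
move=> A0 cB; set N := rep_dim rho in A B A0 cB *.
pose J (A' : 'M[C]_N) := forall g, \tr (A' *m rho g) = 0.
pose S := sum_rep (fun _ : 'I_N => rho).
pose pairing (A' : 'M[C]_N) (w : 'cV[C]_(rep_dim S)) : C :=
  \sum_j (row j A' *m (submxcol w j : 'cV_N)) 0 0.
have pairing_mxcol A' (X : 'M[C]_N) :
    pairing A' (\mxcol_(j < N) col j X) = \tr (A' *m X).
  apply: eq_bigr => j _; rewrite mxcolK -row_mul.
  by rewrite !mxE; apply: eq_bigr => l _; rewrite !mxE.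
have [W WP] : exists W : {vspace 'cV[C]_(rep_dim S)},
    forall w, w \in W <-> forall A', J A' -> pairing A' w = 0.
  apply: vspace_of_pred => [A' _|a u v Pu Pv A' JA'].
    by rewrite /pairing big1 // => j _; rewrite submxcol0 mulmx0 mxE.
  rewrite (_ : pairing _ _ = a * pairing A' u + pairing A' v); last first.
    rewrite /pairing mulr_sumr -big_split /=; apply: eq_bigr => j _.
    have -> : submxcol (a *: u + v) j = a *: submxcol u j + submxcol v j.
      by apply/matrixP => k l; rewrite !mxE.
    by rewrite mulmxDr -scalemxAr !mxE.
  by rewrite Pu // Pv // mulr0 addr0.
have invW : invariant W.
  move=> g w /WP Ww; apply/WP => A' JA'.
  have JA'g : J (A' *m rho g) by move=> h; rewrite -mulmxA -rep_mxM.
  rewrite -(Ww _ JA'g); apply: eq_bigr => j _.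
  rewrite row_mul -mulmxA; congr ((_ *m _) 0 0).
  by rewrite -[w in LHS]submxcolK /= /sum_mx mul_mxdiag_mxcol mxcolK.
have [k [D [uD WD cD]]] := invariant_projector invW.
set P := D^t* *m D in cD.
have cPB : P *m \mxdiag_(i < N) B = \mxdiag_(i < N) B *m P.
  apply/(@sum_rep_commP _ (fun _ : 'I_N => rho)) => i j.
  apply: cB => g; move: i j; clearbody P.
  exact: (sum_rep_commP (r := fun _ : 'I_N => rho) P (fun=> rho g)).1 (cD g).
have W1 : \mxcol_(j < N) col j (1%:M : 'M[C]_N) \in W.
  by apply/WP => A' JA'; rewrite pairing_mxcol -(JA' 1%g) rep_mx1.
have WB : \mxcol_(j < N) col j B \in W.
  have -> : \mxcol_(j < N) col j B =
      \mxdiag_(i < N) B *m \mxcol_(j < N) col j (1%:M : 'M[C]_N).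
    rewrite mul_mxdiag_mxcol; apply: eq_mxcol => j.
    by rewrite !colE mul1mx.
  apply/WD; rewrite mulmxA -/P mulmxA cPB -mulmxA; congr (_ *m _).
  by rewrite -[P *m _]mulmxA; apply/WD.
by rewrite -pairing_mxcol; apply: (WP _).1 WB _ A0.
Qed.

Definition inequivalent_irreps m (r : 'I_m -> rep) :=
  (forall i, irreducible_rep (r i)) /\
  forall i j, equiv_rep (r i) (r j) -> i = j.

(** Frobenius and Schur: coefficient functions of inequivalent irreducible
    representations are linearly independent.  By Schur's lemma the commutant
    of their sum consists of block scalars, so every block diagonal matrix is
    in the bicommutant. *)
Lemma coefficients_free m (r : 'I_m -> rep) (A : forall i, 'M[C]_(rep_dim (r i))) :
  inequivalent_irreps r ->
  (forall g, \sum_i \tr (A i *m r i g) = 0) -> forall i, A i = 0.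
Proof.
move=> [irr ineq] A0 i.
suff : \mxdiag_i A i = 0.
  move=> /(congr1 (fun X => submxblock X i i)).
  by rewrite submxblock_diag submxblock0.
apply: mxtrace_adj_eq0; rewrite adj_mxdiag.
apply: (@bicommutant (sum_rep r)) => [g|T cT].
  by rewrite /= /sum_mx mxdiagM mxtrace_mxdiag.
apply/sum_rep_commP => k l.
have cTkl g : submxblock T k l *m r l g = r k g *m submxblock T k l.
  by move: k l; apply/sum_rep_commP; exact: cT.
case: (eqVneq (submxblock T k l) 0) => [->|T0].
  by rewrite mul0mx mulmx0.
have kl := ineq _ _ (schur_equiv (irr l) (irr k) cTkl T0).
subst l.
have [a ->] := schur_scalar (irr k) cTkl.
by rewrite mul_mx_scalar mul_scalar_mx.
Qed.

Definition coefficient_span m (r : 'I_m -> rep) : set (G -> C) :=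
  [set f | exists A : forall i, 'M[C]_(rep_dim (r i)),
     forall g, f g = \sum_i \tr (A i *m r i g)].

Lemma coefficient_spanD m (r : 'I_m -> rep) f1 f2 :
  coefficient_span r f1 -> coefficient_span r f2 ->
  coefficient_span r (fun g => f1 g + f2 g).
Proof.
move=> [A1 f1E] [A2 f2E]; exists (fun i => A1 i + A2 i) => g.
rewrite f1E f2E -big_split; apply: eq_bigr => i _.
by rewrite mulmxDl mxtraceD.
Qed.

Lemma equiv_rep_sym rho sigma : equiv_rep rho sigma -> equiv_rep sigma rho.
Proof.
move=> [U [uU uU' cU]]; exists (U^t*); split=> //; first by rewrite trmxCK.
exact: intertwiner_adj.
Qed.

Lemma equiv_rep_trans rho sigma tau :
  equiv_rep rho sigma -> equiv_rep sigma tau -> equiv_rep rho tau.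
Proof.
move=> [U [uU uU' cU]] [V [uV uV' cV]]; exists (V *m U); split.
- exact: mul_unitarymx.
- by rewrite adjM; exact: mul_unitarymx.
- by move=> g; rewrite -mulmxA cU mulmxA cV mulmxA.
Qed.

Lemma equiv_rep_refl rho : equiv_rep rho rho.
Proof.
exists 1%:M; rewrite adj1; split; last by move=> g; rewrite mul1mx mulmx1.
- by apply/unitarymxP; rewrite adj1 mulmx1.
- by apply/unitarymxP; rewrite adj1 mulmx1.
Qed.

Lemma mxtrace_equiv rho sigma A : equiv_rep rho sigma ->
  exists A', forall g, \tr (A *m rho g) = \tr (A' *m sigma g).
Proof.
move=> [U [uU uU' cU]]; exists (U *m A *m U^t*) => g.
have UU : U^t* *m U = 1%:M by have := unitarymxP uU'; rewrite trmxCK.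
rewrite -[rho g]mul1mx -UU -[U^t* *m U *m _]mulmxA cU !mulmxA mxtrace_mulC.
by rewrite !mulmxA.
Qed.

(** A representation equivalent to a member of the family contributes nothing
    new; otherwise it is appended to the family. *)
Lemma coefficient_span_add m (r : 'I_m -> rep) sigma :
  inequivalent_irreps r -> irreducible_rep sigma ->
  exists m' (r' : 'I_m' -> rep), [/\ inequivalent_irreps r',
    coefficient_span r `<=` coefficient_span r'
    & forall A, coefficient_span r' (fun g => \tr (A *m sigma g))].
Proof.
move=> rI irr_s.
have [[i ri]|nri] := pselect (exists i, equiv_rep sigma (r i)).
  exists m, r; split=> // A; have [A' A'E] := mxtrace_equiv A ri.
  exists (dfwith (fun j => 0 : 'M[C]_(rep_dim (r j))) A') => g.
  rewrite A'E (bigD1 i) //= dfwith_in big1 ?addr0 // => j ji.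
  by rewrite dfwith_out 1?eq_sym // mul0mx mxtrace0.
pose r' (o : option 'I_m) := oapp r sigma o.
pose A' (A : forall i, 'M[C]_(rep_dim (r i))) (B : 'M[C]_(rep_dim sigma)) o :
  'M[C]_(rep_dim (r' o)) :=
  if o is Some i then A i else B.
have A'E A B g : \sum_j \tr (A' A B (unlift ord0 j) *m r' (unlift (@ord0 m) j) g) =
    \tr (B *m sigma g) + \sum_i \tr (A i *m r i g).
  rewrite big_ord_recl unlift_none; congr (_ + _); apply: eq_bigr => j _.
  by rewrite liftK.
exists m.+1, (fun j => r' (unlift ord0 j)); split; first split.
- by move=> j; case: unliftP => [i _|_]; [exact: rI.1|].
- move=> j k; case: unliftP => [i ->|->]; case: unliftP => [l ->|->] //= e.
  + by congr lift; exact: rI.2.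
  + by case: nri; exists i; exact: equiv_rep_sym.
  + by case: nri; exists l.
- move=> f [A fE]; exists (fun j => A' A 0 (unlift ord0 j)) => g.
  by rewrite fE A'E mul0mx mxtrace0 add0r.
- move=> B; exists (fun j => A' (fun=> 0) B (unlift ord0 j)) => g.
  by rewrite A'E big1 ?addr0 // => i _; rewrite mul0mx mxtrace0.
Qed.

Lemma coefficient_span_merge m1 (r1 : 'I_m1 -> rep) m2 (r2 : 'I_m2 -> rep) :
  inequivalent_irreps r1 -> (forall i, irreducible_rep (r2 i)) ->
  exists m (r : 'I_m -> rep), [/\ inequivalent_irreps r,
    coefficient_span r1 `<=` coefficient_span r
    & coefficient_span r2 `<=` coefficient_span r].
Proof.
move=> r1I; elim: m2 r2 => [|m2 IH] r2 irr2.
  exists m1, r1; split=> // f [A fE]; exists (fun i => 0) => g.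
  by rewrite fE big_ord0 big1 // => i _; rewrite mul0mx mxtrace0.
have [m [r [rI r1r r2r]]] := IH (r2 \o lift ord0) (fun i => irr2 _).
have [m' [r' [r'I rr' sr']]] := coefficient_span_add rI (irr2 ord0).
exists m', r'; split=> //; first by move=> f /r1r /rr'.
move=> f [A fE].
rewrite (_ : f = fun g => \tr (A ord0 *m r2 ord0 g) +
    \sum_i \tr (A (lift ord0 i) *m r2 (lift ord0 i) g)); last first.
  by apply/funext => g; rewrite fE big_ord_recl.
apply: coefficient_spanD; first exact: sr'.
by apply/rr'/r2r; exists (fun i => A (lift ord0 i)).
Qed.

Lemma coefficient_span_exists rho A : exists m (r : 'I_m -> rep),
  inequivalent_irreps r /\ coefficient_span r (fun g => \tr (A *m rho g)).
Proof.
pose X : set (G -> C) := [set f | exists m (r : 'I_m -> rep),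
  inequivalent_irreps r /\ coefficient_span r f].
have r0I (r : 'I_0 -> rep) : inequivalent_irreps r by split=> [] [].
apply: (coefficient_ind (X := X)).
- exists 0%N, (fun=> rho); split=> //; exists (fun i => 0) => g.
  by rewrite big_ord0.
- move=> f1 f2 [m1 [r1 [r1I f1r]]] [m2 [r2 [r2I f2r]]].
  have [m [r [rI r1r r2r]]] := coefficient_span_merge r1I r2I.1.
  by exists m, r; split=> //; apply: coefficient_spanD; [exact: r1r|exact: r2r].
- move=> sigma B irr; have [m [r [rI _ sr]]] := coefficient_span_add (r0I (fun=> rho)) irr.
  by exists m, r.
Qed.

End Coefficients.

(** * Representations fixed by the automorphism *)

Section FixedReps.
Local Open Scope ring_scope.
Local Open Scope sesquilinear_scope.
Variables (R : realType) (G : groupType) (phi : automorphism G).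
Local Notation C := (R[i]).
Local Notation rep := (unitary_rep R G).
Implicit Types rho sigma tau : rep.

Lemma pullback_irreducible rho :
  irreducible_rep rho -> irreducible_rep (pullback_rep rho phi).
Proof.
move=> [d_gt0 irr]; split=> // W invW; apply: irr => g v Wv.
by rewrite -(aut_invK phi g); exact: invW.
Qed.

Definition fixed_rep rho := equiv_rep (pullback_rep rho phi) rho.

Lemma fixed_intertwiner rho : fixed_rep rho -> exists V : 'M[C]_(rep_dim rho),
  V \is unitarymx /\ forall g, V *m rho g = rho (phi g) *m V.
Proof.
move=> [U [uU uU' cU]]; exists (U^t*); split=> // g.
exact: (@intertwiner_adj _ _ (pullback_rep rho phi) rho).
Qed.

Lemma unitarymx_neq0 n (V : 'M[C]_n) : (0 < n)%N -> V \is unitarymx -> V != 0.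
Proof.
move=> n_gt0 uV; apply/eqP => V0; have := mxrank_unitary uV.
by rewrite V0 mxrank0 => n0; rewrite -n0 in n_gt0.
Qed.

(** The functions [\tr (V *m rho x)], for [V] intertwining [rho] with its
    pullback, are constant on twisted conjugacy classes and linearly
    independent. *)
Lemma fixed_reps_le_classes k (r : 'I_k -> rep) n (x : 'I_n -> G) :
  inequivalent_irreps r -> (forall i, fixed_rep (r i)) ->
  (forall g, exists j, twisted_conj phi g (x j)) -> (k <= n)%N.
Proof.
move=> rI fixr cover.
have V_ex i := cid (fixed_intertwiner (fixr i)).
pose V i := projT1 (V_ex i).
have uV i : V i \is unitarymx := (projT2 (V_ex i)).1.
have cV i g : V i *m r i g = r i (phi g) *m V i := (projT2 (V_ex i)).2 g.
have inv i g h : twisted_conj phi g h -> \tr (V i *m r i g) = \tr (V i *m r i h).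
  move=> [u ->]; rewrite !rep_mxM !mulmxA [in RHS]cV [RHS]mxtrace_mulC !mulmxA -rep_mxM.
  by rewrite -gmulfM mulVg mult1 rep_mx1 mul1mx.
pose F : 'M[C]_(k, n) := \matrix_(i, j) \tr (V i *m r i (x j)).
suff Ffree : row_free F by rewrite -(eqP Ffree) rank_leq_col.
rewrite -kermx_eq0; apply/eqP/row_matrixP => l; rewrite row0.
set u := row l _.
have uF : u *m F = 0 by rewrite -row_mul mulmx_ker row0.
have u0 : forall i, u 0 i *: V i = 0.
  apply: coefficients_free rI _ => g; have [j gj] := cover g.
  have := congr1 (fun X : 'rV_n => X 0 j) uF; rewrite [LHS]mxE [RHS]mxE => uFj.
  rewrite -[RHS]uFj.
  apply: eq_bigr => i _; rewrite -scalemxAl linearZ /= (inv _ _ _ gj).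
  by rewrite [F i j]mxE.
apply/rowP => i; rewrite [RHS]mxE; have /eqP := u0 i.
by rewrite scaler_eq0 (negPf (unitarymx_neq0 (rI.1 i).1 (uV i))) orbF => /eqP.
Qed.

Section FiniteQuotient.
Variables (Q : finGroupType) (q : {multiplicative G -> Q}).

Definition regular_fun (g : G) (a : 'I_#|Q|) := enum_rank ((q g)^-1 * enum_val a)%g.

Lemma regular_fun_inj g : injective (regular_fun g).
Proof. by move=> a b /enum_rank_inj /mulgI /enum_val_inj. Qed.

Definition regular_mx (g : G) : 'M[C]_#|Q| := perm_mx (perm (@regular_fun_inj g)).

Lemma regular_mx1 : regular_mx 1%g = 1%:M.
Proof.
rewrite -perm_mx1 /regular_mx; congr perm_mx; apply/permP => a.
by rewrite perm1 permE /regular_fun mult1 invg1 mul1g enum_valK.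
Qed.

Lemma regular_mxM g h : regular_mx (g * h)%g = regular_mx g *m regular_mx h.
Proof.
rewrite -perm_mxM /regular_mx; congr perm_mx; apply/permP => a.
by rewrite permM !permE /regular_fun enum_rankK gmulfM invgM mulgA.
Qed.

Lemma regular_mx_unitary g : regular_mx g \is unitarymx.
Proof.
apply/unitarymxP; rewrite tr_perm_mx map_perm_mx -perm_mxM mulgV.
exact: perm_mx1.
Qed.

Definition regular_rep : rep := UnitaryRep regular_mx1 regular_mxM regular_mx_unitary.

(** The entries in the column of index 1 of the regular matrices are the
    indicator functions of the points of [Q]. *)
Lemma quotient_coefficient (F : Q -> C) : exists A,
  forall g, F (q g) = \tr (A *m regular_rep g).
Proof.
pose b := enum_rank (1%g : Q).
exists (\matrix_(i, a) (if i == b then F (enum_val a) else 0)) => g.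
rewrite /mxtrace (bigD1 b) //= [X in _ = _ + X]big1 ?addr0; last first.
  move=> i ib; rewrite mxE big1 // => a _.
  by rewrite !mxE (negPf ib) mul0r.
rewrite mxE (bigD1 (enum_rank (q g))) //= big1 ?addr0.
  rewrite !mxE eqxx enum_rankK permE /regular_fun enum_rankK mulVg eqxx.
  by rewrite mulr1.
move=> a aq; rewrite !mxE permE /regular_fun eqxx.
case: eqP => [e|_]; last by rewrite mulr0.
case/eqP: aq; apply: enum_val_inj; rewrite enum_rankK.
by move: e => /enum_rank_inj /(canRL (mulKVg _)); rewrite mulg1.
Qed.

End FiniteQuotient.

Lemma coefficient_span_family k (rho : 'I_k -> rep) (A : forall j, 'M[C]_(rep_dim (rho j))) :
  exists m (r : 'I_m -> rep), inequivalent_irreps r /\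
    forall j, coefficient_span r (fun g => \tr (A j *m rho j g)).
Proof.
elim: k rho A => [|k IH] rho A.
  (* Any representation will do as the default of an empty family. *)
  pose one_mor := multiplicative_of (fun x y : G => esym (mulg1 (1%g : {perm 'I_1}))).
  pose triv : rep := regular_rep one_mor.
  by exists 0%N, (fun=> triv); split=> [|[]//]; split=> [] [].
have [m1 [r1 [r1I r1A]]] := IH (fun j => rho (lift ord0 j)) (fun j => A (lift ord0 j)).
have [m2 [r2 [r2I r2A]]] := coefficient_span_exists (A ord0).
have [m [r [rI r1r r2r]]] := coefficient_span_merge r1I r2I.1.
exists m, r; split=> // j; case: (unliftP ord0 j) => [l ->|->].
  exact/r1r/r1A.
exact/r2r/r2A.
Qed.

(** Twisted class functions of a finite quotient are combinations of the traces
    attached to fixed representations: writing such a function with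
    coefficients of inequivalent representations, its invariance forces each
    coefficient matrix to be an intertwiner between the representation and its
    pullback, so a scalar multiple of one matrix, or zero. *)
Lemma classes_le_fixed_reps (Q : finGroupType) (q : {multiplicative G -> Q})
    (phibar : automorphism Q) k (x : 'I_k -> Q) :
  set_surj [set: G] [set: Q] q -> (forall g, q (phi g) = phibar (q g)) ->
  twisted_free phibar x ->
  exists r : 'I_k -> rep, inequivalent_irreps r /\ forall i, fixed_rep (r i).
Proof.
move=> qsurj qphi xfree.
pose F j y : C := (`[< twisted_conj phibar y (x j) >])%:R.
have /choice [A AE] : forall j, exists A, forall g, F j (q g) = \tr (A *m regular_rep q g).
  by move=> j; exact: quotient_coefficient.
have [m [r [rI rA]]] := coefficient_span_family A.
have /choice [B BE] : forall j, exists B : forall i, 'M[C]_(rep_dim (r i)),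
    forall g, F j (q g) = \sum_i \tr (B i *m r i g).
  by move=> j; have [B BE] := rA j; exists B => g; rewrite AE BE.
have Finv j g u : F j (q (u * g * phi u^-1)%g) = F j (q g).
  congr (_%:R); congr nat_of_bool; apply/asboolP/asboolP => h.
    apply: twisted_conj_trans h; exists (q u).
    by rewrite !gmulfM qphi !multV.
  apply: twisted_conj_trans h; apply: twisted_conj_sym; exists (q u).
  by rewrite !gmulfM qphi !multV.
have Bint j i g : B j i *m r i g = r i (phi g) *m B j i.
  have B0 : forall i, r i (phi g^-1%g) *m B j i *m r i g - B j i = 0.
    apply: coefficients_free rI _ => h.
    have := Finv j h g; rewrite !BE => /eqP; rewrite -subr_eq0 -sumrB => /eqP e0; rewrite -[RHS]e0.
    apply: eq_bigr => l _; rewrite mulmxBl raddfB /=; congr (_ - _).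
    by rewrite !rep_mxM [in RHS]mulmxA [RHS]mxtrace_mulC !mulmxA.
  have /eqP := B0 i; rewrite subr_eq0 => /eqP {2}<-.
  by rewrite !mulmxA -rep_mxM -gmulfM mulgV mult1 rep_mx1 mul1mx.
have fix_or_0 j i : B j i != 0 -> fixed_rep (r i).
  move=> B0; apply: equiv_rep_sym.
  exact: (@schur_equiv _ _ (r i) (pullback_rep (r i) phi) _ (rI.1 i)
    (pullback_irreducible (rI.1 i)) (Bint j i) B0).
have V_ex i : exists V, fixed_rep (r i) ->
    forall j, exists a, B j i = a *: (V : 'M[C]_(rep_dim (r i))).
  have [/fixed_intertwiner [V [uV cV]]|nf] := pselect (fixed_rep (r i)); last by exists 0.
  exists V => _ j.
  have VV : V *m V^t* = 1%:M := unitarymxP uV.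
  have cV' := intertwiner_adj (rho := r i) (sigma := pullback_rep (r i) phi) cV.
  have [|a aE] := schur_scalar (T := V^t* *m B j i) (rI.1 i).
    by move=> g; rewrite -mulmxA Bint mulmxA cV' mulmxA.
  by exists a; rewrite -[LHS]mul1mx -VV -mulmxA aE mul_mx_scalar.
pose V i := projT1 (cid (V_ex i)).
pose fixset := [set i | `[< fixed_rep (r i) >]]%SET.
have fixP i : i \in fixset -> fixed_rep (r i) by rewrite !inE.
have /choice [c cE] : forall ji : 'I_k * 'I_m, exists a,
    B ji.1 ji.2 = a *: V ji.2.
  move=> [j i] /=; case: (eqVneq (B j i) 0) => [->|B0]; first by exists 0; rewrite scale0r.
  exact: (projT2 (cid (V_ex i)) (fix_or_0 j i B0) j).
pose M : 'M[C]_(k, #|fixset|) := \matrix_(j, l) c (j, enum_val l).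
have le_k : (k <= #|fixset|)%N.
  suff Mfree : row_free M by rewrite -(eqP Mfree) rank_leq_col.
  rewrite -kermx_eq0; apply/eqP/row_matrixP => l; rewrite row0.
  set u := row l _.
  have uM : u *m M = 0 by rewrite -row_mul mulmx_ker row0.
  have uF g : \sum_j u 0 j * F j (q g) = 0.
    under eq_bigr do rewrite BE mulr_sumr.
    rewrite exchange_big big1 // => i _.
    have [fi|nfi] := boolP (i \in fixset); last first.
      rewrite big1 // => j _; case: (eqVneq (B j i) 0) => [->|/fix_or_0 fi].
        by rewrite mul0mx mxtrace0 mulr0.
      by case/negP: nfi; rewrite !inE.
    under eq_bigr => j _ do rewrite (cE (j, i)) -scalemxAl linearZ /= mulrA.
    rewrite -mulr_suml (_ : \sum_j _ = 0) ?mul0r //.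
    have := congr1 (fun X : 'rV_#|fixset| => X 0 (enum_rank_in fi i)) uM.
    rewrite [LHS]mxE [RHS]mxE => uMi; rewrite -[RHS]uMi; apply: eq_bigr => j _.
    by rewrite [M _ _]mxE enum_rankK_in.
  apply/rowP => j; rewrite [RHS]mxE.
  have [g _ gx] := qsurj (x j) I.
  rewrite -(uF g) (bigD1 j) //= big1 ?addr0 => [|j' j'j].
    by rewrite /F gx asboolT ?mulr1 //; exact: twisted_conj_refl.
  rewrite /F gx asboolF ?mulr0 // => /xfree jj'.
  by rewrite jj' eqxx in j'j.
exists (fun i => r (enum_val (widen_ord le_k i))); split; last first.
  by move=> i; exact/fixP/enum_valP.
split=> [i|i j /rI.2 /enum_val_inj /(congr1 val) /= ij]; first exact: rI.1.
exact: val_inj.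
Qed.

End FixedReps.

(** * Counting classes *)

Section Counting.
Variables (T : Type).
Implicit Types A : set T.

(** Cardinality at least [k], which compares sets of different types without a
    map between them. *)
Definition has_distinct A (k : nat) :=
  exists f : 'I_k -> T, injective f /\ forall i, A (f i).

Lemma finite_has_distinct A : finite_set A ->
  exists n, forall k, has_distinct A k -> (k <= n)%N.
Proof.
move=> [n /card_set_bijP [h [hA hinj _]]]; exists n => k [f [finj fA]].
have lt_n i : (h (f i) < n)%N by exact: (hA _ (fA i)).
have : injective (fun i => Ordinal (lt_n i)).
  by move=> i j [/(hinj _ _ (mem_set (fA i)) (mem_set (fA j)))]; exact: finj.
by move=> /leq_card; rewrite !card_ord.
Qed.

Lemma card_has_distinct A n : has_distinct A n -> ~ has_distinct A n.+1 -> A #= `I_n.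
Proof.
move=> [f [finj fA]] nS.
have fsurj a : A a -> exists i, f i = a.
  move=> Aa; apply: contrapT => na; apply: nS.
  exists (fun j => oapp f a (unlift ord0 j)); split=> [i j|i]; last first.
    by case: unliftP => [l _|_] //=; exact: fA.
  case: unliftP => [i' ->|->]; case: unliftP => [j' ->|->] //=.
  - by move=> /finj ->.
  - by move=> fa; case: na; exists i'.
  - by move=> fa; case: na; exists j'.
apply: card_esym; apply: card_eq_trans card_II _.
rewrite (_ : A = f @` setT); last first.
  by apply/seteqP; split=> [a /fsurj [i <-]|_ [i _ <-]] //; exists i.
by apply: card_esym; apply: inj_card_eq => i j _ _; exact: finj.
Qed.

End Counting.

Section CommonQuotient.
Local Open Scope group_scope.
Variables (G : groupType) (phi : automorphism G).

(** The image of [G] in a product of two compatible quotients is compatible and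
    separates what either of them separates. *)
Lemma common_quotient (s : seq (G * G)) : twisted_conjugacy_separable phi ->
  exists (Q : finGroupType) (q : {multiplicative G -> Q}) (phibar : automorphism Q),
    [/\ set_surj [set: G] [set: Q] q, forall g, q (phi g) = phibar (q g)
      & forall p, p \in s -> ~ twisted_conj phi p.1 p.2 ->
          ~ twisted_conj phibar (q p.1) (q p.2)].
Proof.
move=> sep; elim: s => [|p s [Q1 [q1 [phi1 [surj1 comm1 sep1]]]]].
  have fin : finite_mod [set: G] [set: G] by exists [:: 1] => h _; exists 1; rewrite ?mem_head.
  have [Q [q [phibar [qsurj qphi _]]]] :=
    invariant_quotient (phi := phi) (subgroupT G) (fun x g _ => I) fin (fun x => iff_refl _).
  by exists Q, q, phibar; split.
have [np|cp] := pselect (~ twisted_conj phi p.1 p.2); last first.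
  exists Q1, q1, phi1; split=> // p'; rewrite inE => /orP [/eqP ->|]; last exact: sep1.
  by [].
have [Q2 [q2 [phi2 [surj2 comm2 sep2]]]] := sep _ _ np.
have fM : {morph (fun g => (q1 g, q2 g) : Q1 * Q2) : x y / x * y}.
  by move=> x y; rewrite !gmulfM.
have [Q [q [iota [qsurj iota_inj qf]]]] := image_quotient (multiplicative_of fM).
have q1E x : q x = 1 <-> q1 x = 1 /\ q2 x = 1.
  split=> [qx|[q1x q2x]].
    have := qf x; rewrite qx mult1 /= => -[].
    by move=> <- <-.
  by apply: iota_inj; rewrite qf mult1 /= q1x q2x.
have [phibar phibarP] : exists phibar : automorphism Q, forall g, q (phi g) = phibar (q g).
  apply: induced_automorphism => // x; rewrite !q1E comm1 comm2.
  have aut1 (H : groupType) (psi : automorphism H) y : psi y = 1 <-> y = 1.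
    by split=> [|->]; [rewrite -{1}(mult1 psi) => /(can_inj (aut_morK psi))|exact: mult1].
  by rewrite !aut1.
have proj g h : twisted_conj phibar (q g) (q h) ->
    twisted_conj phi1 (q1 g) (q1 h) /\ twisted_conj phi2 (q2 g) (q2 h).
  move=> [w]; have [u _ <-] := qsurj w I.
  rewrite -multV -phibarP -!gmulfM => /(congr1 iota); rewrite !qf /= => -[e1 e2].
  split; [exists (q1 u)|exists (q2 u)].
    by rewrite e1 !gmulfM comm1 !multV.
  by rewrite e2 !gmulfM comm2 !multV.
exists Q, q, phibar; split=> // p'; rewrite inE => /orP [/eqP -> _|ps np'].
  by move=> /proj [_]; exact: sep2.
by move=> /proj [/(sep1 _ ps np')].
Qed.

Lemma twisted_free_quotient k (x : 'I_k -> G) : twisted_conjugacy_separable phi ->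
  twisted_free phi x ->
  exists (Q : finGroupType) (q : {multiplicative G -> Q}) (phibar : automorphism Q),
    [/\ set_surj [set: G] [set: Q] q, forall g, q (phi g) = phibar (q g)
      & twisted_free phibar (q \o x)].
Proof.
move=> sep xfree.
have [Q [q [phibar [qsurj qphi qsep]]]] :=
  common_quotient [seq (x i, x j) | i <- enum 'I_k, j <- enum 'I_k] sep.
exists Q, q, phibar; split=> // i j qij; apply: contrapT => nij.
apply: (qsep (x i, x j)) qij; last by move=> /xfree.
by apply/allpairsP; exists (i, j); rewrite !mem_enum.
Qed.

Lemma twisted_free_lift (Q : finGroupType) (q : {multiplicative G -> Q})
    (phibar : automorphism Q) k (x : 'I_k -> Q) :
  set_surj [set: G] [set: Q] q -> (forall g, q (phi g) = phibar (q g)) ->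
  twisted_free phibar x -> exists y : 'I_k -> G, twisted_free phi y.
Proof.
move=> qsurj qphi xfree.
have /choice [y yx] : forall i, exists y, q y = x i.
  by move=> i; have [y _ yx] := qsurj (x i) I; exists y.
exists y => i j [g e]; apply: xfree; exists (q g).
by rewrite -!yx e !gmulfM qphi !multV.
Qed.

Lemma twisted_classes_distinct k :
  has_distinct (twisted_classes phi) k <-> exists x : 'I_k -> G, twisted_free phi x.
Proof.
split=> [[f [finj fA]]|[x xfree]].
  have /choice [x xP] : forall i, exists x, [set y | twisted_conj phi x y] = f i.
    by move=> i; have [x _ xf] := fA i; exists x.
  exists x => i j ij; apply: finj; rewrite -!xP; apply/seteqP; split=> y /= h.
    exact: twisted_conj_trans (twisted_conj_sym ij) h.
  exact: twisted_conj_trans ij h.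
exists (fun i => [set y | twisted_conj phi (x i) y]); split=> [i j e|i]; last by exists (x i).
apply: xfree; have : [set y | twisted_conj phi (x j) y] (x j) by exact: twisted_conj_refl.
by rewrite -e.
Qed.

Lemma fixed_rep_classes_distinct (R : realType) k :
  has_distinct (fixed_rep_classes R phi) k <->
  exists r : 'I_k -> unitary_rep R G,
    inequivalent_irreps r /\ forall i, fixed_rep phi (r i).
Proof.
split=> [[f [finj fA]]|[r [[irr ineq] fixr]]].
  have /choice [r rP] : forall i, exists r : unitary_rep R G,
      (irreducible_rep r /\ fixed_rep phi r) /\
      [set sigma | irreducible_rep sigma /\ equiv_rep r sigma] = f i.
    by move=> i; have [r rr rf] := fA i; exists r.
  exists r; split=> [|i]; last exact: (rP i).1.2.
  split=> [i|i j ij]; first exact: (rP i).1.1.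
  apply: finj; rewrite -(rP i).2 -(rP j).2; apply/seteqP; split=> tau [irr h]; split=> //.
    exact: equiv_rep_trans (equiv_rep_sym ij) h.
  exact: equiv_rep_trans ij h.
exists (fun i => [set sigma | irreducible_rep sigma /\ equiv_rep (r i) sigma]).
split=> [i j e|i]; last by exists (r i) => //; split; [exact: irr|exact: fixr].
have : [set sigma | irreducible_rep sigma /\ equiv_rep (r j) sigma] (r j).
  by split=> //; exact: equiv_rep_refl.
by rewrite -e => -[_] /ineq.
Qed.

End CommonQuotient.

Unset Implicit Arguments.
Set Strict Implicit.

Theorem theorem7p8 (R : realType) (G : groupType) (phi : automorphism G)
    (G_countable : countable [set: G])
    (G_separable :
       [\/ almost_polycyclic G,
           exists C : groupType -> Prop,
             [/\ forall H : groupType, C H ->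
                   countable [set: H] /\ conjugacy_separable H,
                 closed_semidirectZ C & C G]
         | twisted_conjugacy_separable phi])
    (R_or_S_finite :
       finite_set (twisted_classes phi) \/
       finite_set (fixed_rep_classes R phi)) :
  twisted_classes phi #= fixed_rep_classes R phi.
Proof.
have [M bM] : exists M, bounded_twisted_classes phi M.
  case: R_or_S_finite => /finite_has_distinct [M MP]; exists M.
    move=> Q q phibar qsurj qphi k x xfree; apply: MP.
    by apply/twisted_classes_distinct; exact: twisted_free_lift qsurj qphi xfree.
  move=> Q q phibar qsurj qphi k x xfree; apply: MP.
  by apply/fixed_rep_classes_distinct; exact: classes_le_fixed_reps qsurj qphi xfree.
have sep : twisted_conjugacy_separable phi.
  case: G_separable => [ap|[C [Csep Cclosed CG]]|//].
    exact: almost_polycyclic_separable ap bM.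
  apply: conjugacy_separable_semidirectZ.
  exact: (Csep _ (Cclosed _ _ CG)).2.
have le_M k : has_distinct (twisted_classes phi) k -> (k <= M)%N.
  move=> /twisted_classes_distinct [x xfree].
  have [Q [q [phibar [qsurj qphi qfree]]]] := twisted_free_quotient sep xfree.
  exact: bM qsurj qphi _ _ qfree.
pose pd k := `[< has_distinct (twisted_classes phi) k >].
have ex0 : exists k, pd k.
  by exists 0%N; apply/asboolP/twisted_classes_distinct; exists (fun=> 1%g) => -[].
have ub k : pd k -> (k <= M)%N by move=> /asboolP /le_M.
case: (ex_maxnP ex0 ub) => n /asboolP An nmax.
have nA : ~ has_distinct (twisted_classes phi) n.+1.
  by move=> An1; have := nmax n.+1 (asboolT An1); rewrite ltnn.
have [x xfree] := (twisted_classes_distinct phi n).1 An.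
have Sn : has_distinct (fixed_rep_classes R phi) n.
  have [Q [q [phibar [qsurj qphi qfree]]]] := twisted_free_quotient sep xfree.
  by apply/fixed_rep_classes_distinct; exact: classes_le_fixed_reps qsurj qphi qfree.
have cover g : exists j, twisted_conj phi g (x j).
  apply: contrapT => ng; apply: nA; apply/twisted_classes_distinct.
  exists (fun j => oapp x g (unlift ord0 j)) => i j.
  case: unliftP => [i' ->|->]; case: unliftP => [j' ->|->] //=.
  - by move=> /xfree ->.
  - by move=> /twisted_conj_sym ig; case: ng; exists i'.
  - by move=> gj; case: ng; exists j'.
have nS : ~ has_distinct (fixed_rep_classes R phi) n.+1.
  move=> /fixed_rep_classes_distinct [r [rI fixr]].
  by have := fixed_reps_le_classes rI fixr cover; rewrite ltnn.
apply: card_eq_trans (card_has_distinct An nA) _.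
exact/card_esym/card_has_distinct.
Qed.
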